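(* Let $z=k$ be an integer and let $T_{pq}$ be an arbitrary block of the representation $T_k$ (so $p,q$ are nonnegative integers with $p-q=k$ and $(p,q)\ne(0,0)$). In the space $H(T_{pq})$ there is a $K$-invariant vector $v_{pq}$ such that the corresponding function $f_{pq}(\lambda)=(v_{pq},\xi_\lambda)$, which is supported by $\mathbb Y(p,q)$, has the following form: for every nonempty $\lambda\in\mathbb Y(p,q)$, with $n=|\lambda|$, $$f_{pq}(\lambda)=(-1)^{|\lambda^-|}\,\frac{\sqrt{((p-q)^2+n-1)!\;n!}}{(p^2+q^2-pq+n-1)!}\prod_{1\le i<j\le p}(\lambda_i^+-\lambda_j^++j-i)\prod_{1\le r<s\le q}(\lambda_r^--\lambda_s^-+s-r).$$
   Context: $S(n)$ is the group of permutations of $\{1,\dots,n\}$, identified with the stabilizer of $n+1$ in $S(n+1)$; $S(\infty)=\bigcup_n S(n)$; $G=S(\infty)\times S(\infty)$, $K=\{(s,s):s\in S(\infty)\}\subset G$, $G(n)=S(n)\times S(n)$. The canonical projection $p_{n,n+1}:S(n+1)\to S(n)$ removes $n+1$ from its cycle: for $1\le i\le n$, $(p_{n,n+1}(x))(i)=x(i)$ if $x(i)\le n$, and $=x(n+1)$ if $x(i)=n+1$. $H^n=L^2(S(n))$ with respect to the uniform probability measure; $\mathrm{Reg}^n$ is the representation of $G(n)$ in $H^n$, $(\mathrm{Reg}^n(g)f)(x)=f(g_2^{-1}xg_1)$. For $z\in\mathbb C$, $t=|z|^2$, the isometric $G(n)$-equivariant embedding $L_z^n:H^n\to H^{n+1}$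 is $(L_z^nf)(x)=z\sqrt{\frac{n+1}{t+n}}f(x)$ for $x\in S(n)$ and $(L_z^nf)(x)=\sqrt{\frac{n+1}{t+n}}f(p_{n,n+1}(x))$ for $x\in S(n+1)\setminus S(n)$. $T_z$ is the inductive limit of the $\mathrm{Reg}^n$ along the $L_z^n$, acting in the Hilbert completion $H$ of $\bigcup_nH^n$. $\mathbb Y_n$ is the set of Young diagrams with $n$ boxes; $\pi^\lambda$, $\chi^\lambda$ are the irreducible representation and character of $S(n)$ indexed by $\lambda\in\mathbb Y_n$. $\mathrm{Reg}^n=\bigoplus_{\lambda\in\mathbb Y_n}(\pi^\lambda\times\pi^\lambda)$; $H(\lambda)\subset H^n$ is the corresponding subspace; $\xi_\lambda\in H(\lambda)\subset H$ is the unit vector given by the function $\chi^\lambda\in H^n$. The inner product is linear in the first argument. The sets $\mathbb Y(p,q)$: for $p,q\ge1$, the diagrams containing the box $(p,q)$ but not the box $(p+1,q+1)$; $\mathbb Y(p,0)$, $p\ge1$: diagrams with at most $p$ rows; $\mathbb Y(0,q)$, $q\ge1$: diagrams with at most $q$ columns. For $k\in\mathbb Z$ and $p-q=k$, the block $T_{pq}$ of $T_k$ is the subrepresentation of $T_k$ in the closed subspace $H(T_{pq})\subset H$, the closure of $\bigcup_n\bigoplus_{\lambda\in\mathbb Y_n\cap\mathbb Y(p,q)}H(\lambda)$ ($n\ge1$; an increasing union for $n$ large); $T_k$ is the direct sum of its blocks. For $\lambda\in\mathbb Y(p,q)$: $\lambda^+=(\lambda_1^+,\dots,\lambda_p^+)$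 with $\lambda_i^+=\lambda_i-q$, $1\le i\le p$, and $\lambda^-=(\lambda_1^-,\dots,\lambda_q^-)$ with $\lambda_j^-=(\lambda')_j-p$, $1\le j\le q$, where $\lambda'$ is the transposed diagram; $|\lambda^-|=\sum_j\lambda^-_j$. Empty products equal $1$. *)

(* Defs.v *)
From HB Require Import structures.
From mathcomp Require Import all_boot all_order all_algebra all_fingroup.
From mathcomp Require Import mxrepresentation complex.
From mathcomp Require Import all_classical all_reals all_analysis.

Set Implicit Arguments.
Unset Strict Implicit.
Unset Printing Implicit Defensive.

Import Order.TTheory GRing.Theory Num.Theory.
Import numFieldNormedType.Exports.

Local Open Scope classical_set_scope.
Local Open Scope ring_scope.

(** The points 1, ..., n are the elements 0, ..., n - 1 of ['I_n]; the point
    n + 1 of 1, ..., n + 1 is [ord_max].  Composition convention: products of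
    permutations in the source compose as functions, (x y)(i) = x (y i),
    whereas in 'S_n [(x * y)%g i = y (x i)]; products taken in 'S_n below
    are therefore written in the reverse order. *)

(** * The infinite symmetric group *)

Record Sinf := MkSinf {
  sinf_fun :> nat -> nat;
  sinf_inv : nat -> nat;
  sinf_funK : cancel sinf_fun sinf_inv;
  sinf_invK : cancel sinf_inv sinf_fun;
  sinf_finite : exists n, forall i, (n <= i)%N -> sinf_fun i = i }.

HB.instance Definition _ := gen_eqMixin Sinf.
HB.instance Definition _ := gen_choiceMixin Sinf.

Lemma sinfP (s t : Sinf) : s =1 t -> s = t.
Proof.
case: s t => [f f' fK f'K ff] [g g' gK g'K gf] /= /funext E.
move: gK g'K gf; rewrite -{}E => gK g'K gf.
have E' : f' = g' by apply/funext => i; rewrite -[in LHS](g'K i) fK.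
move: gK g'K gf; rewrite -{}E' => gK g'K gf.
by congr MkSinf; exact: Prop_irrelevance.
Qed.

Definition sinf_one : Sinf :=
  MkSinf (fun=> erefl) (fun=> erefl) (ex_intro _ 0 (fun _ _ => erefl)).

Lemma sinf_inv_finite (s : Sinf) :
  exists n, forall i, (n <= i)%N -> sinf_inv s i = i.
Proof.
have [n sn] := sinf_finite s; exists n => i /sn {1}<-.
exact: sinf_funK.
Qed.

Definition sinf_V (s : Sinf) : Sinf :=
  MkSinf (@sinf_invK s) (@sinf_funK s) (sinf_inv_finite s).

Lemma sinf_mul_finite (s t : Sinf) :
  exists n, forall i, (n <= i)%N -> (s \o t) i = i.
Proof.
have [m sm] := sinf_finite s; have [n tn] := sinf_finite t.
exists (maxn m n) => i; rewrite geq_max => /andP[mi ni] /=.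
by rewrite tn // sm.
Qed.

Definition sinf_mul (s t : Sinf) : Sinf :=
  MkSinf (can_comp (@sinf_funK s) (@sinf_funK t))
         (can_comp (@sinf_invK t) (@sinf_invK s)) (sinf_mul_finite s t).

Fact sinf_mulA : associative sinf_mul.
Proof. by move=> r s t; apply: sinfP. Qed.
Fact sinf_mul1 : left_id sinf_one sinf_mul.
Proof. by move=> s; apply: sinfP. Qed.
Fact sinf_mulr1 : right_id sinf_one sinf_mul.
Proof. by move=> s; apply: sinfP. Qed.
Fact sinf_mulV : left_inverse sinf_one sinf_V sinf_mul.
Proof. by move=> s; apply: sinfP => i /=; exact: sinf_funK. Qed.
Fact sinf_mulrV : right_inverse sinf_one sinf_V sinf_mul.
Proof. by move=> s; apply: sinfP => i /=; exact: sinf_invK. Qed.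

HB.instance Definition _ := isGroup.Build Sinf
  sinf_mulA sinf_mul1 sinf_mulr1 sinf_mulV sinf_mulrV.

Definition ext_fun n (f : 'I_n -> 'I_n) (i : nat) : nat :=
  if insub i is Some k then f k else i.

Lemma ext_funK n (f g : 'I_n -> 'I_n) :
  cancel f g -> cancel (ext_fun f) (ext_fun g).
Proof.
move=> fK i; rewrite {2}/ext_fun; case: insubP => [k _ <-|/negPf i_n].
  by rewrite /ext_fun valK fK.
by rewrite /ext_fun insubF.
Qed.

Lemma ext_fun_finite n (f : 'I_n -> 'I_n) :
  exists m, forall i, (m <= i)%N -> ext_fun f i = i.
Proof. by exists n => i ni; rewrite /ext_fun insubF // ltnNge ni. Qed.

Definition emb n (s : 'S_n) : Sinf :=
  MkSinf (ext_funK (permK s)) (ext_funK (permKV s)) (ext_fun_finite s).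

(** * The canonical projection S(n + 1) -> S(n) *)

Definition proj_fun n (x : 'S_n.+1) (i : 'I_n) : 'I_n :=
  match unlift ord_max (x (lift ord_max i)) with
  | Some j => j
  | None => odflt i (unlift ord_max (x ord_max))
  end.

Lemma proj_fun_lift n (x : 'S_n.+1) (i : 'I_n) :
  lift ord_max (proj_fun x i) =
  if x (lift ord_max i) == ord_max then x ord_max else x (lift ord_max i).
Proof.
rewrite /proj_fun; case: unliftP => [j E|E].
  by rewrite E eq_sym (negPf (neq_lift _ _)).
rewrite E eqxx; case: unliftP => [j -> //|E'].
have /perm_inj/eqP : x (lift ord_max i) = x ord_max by rewrite E E'.
by rewrite eq_sym (negPf (neq_lift _ _)).
Qed.

Lemma proj_fun_inj n (x : 'S_n.+1) : injective (proj_fun x).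
Proof.
move=> i i' /(congr1 (lift ord_max)); rewrite !proj_fun_lift.
case: eqP => [E|_]; case: eqP => [E'|_].
- by move=> _; apply: (@lift_inj _ ord_max); apply: (@perm_inj _ x); rewrite E.
- by move=> /perm_inj/eqP; rewrite (negPf (neq_lift _ _)).
- by move=> /perm_inj/eqP; rewrite eq_sym (negPf (neq_lift _ _)).
- by move=> /perm_inj/lift_inj.
Qed.

Definition proj n (x : 'S_n.+1) : 'S_n := perm (@proj_fun_inj n x).

(** * Young diagrams *)

(** A Young diagram is the sequence of the lengths of its nonempty rows. *)
Definition young_diagram (n : nat) (la : seq nat) : bool :=
  [&& sorted geq la, all (ltn 0) la & sumn la == n].

(** Rows, columns and boxes are numbered from 1. *)
Definition row_len (la : seq nat) (i : nat) : nat := nth 0%N la i.-1.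
Definition col_len (la : seq nat) (j : nat) : nat :=
  count (fun r => j <= r)%N la.
Definition has_box (la : seq nat) (i j : nat) : bool :=
  [&& (0 < i)%N, (0 < j)%N & (j <= row_len la i)%N].

(** Meaningful for (p, q) <> (0, 0) only. *)
Definition in_Y (p q : nat) (la : seq nat) : bool :=
  if q == 0%N then (size la <= p)%N
  else if p == 0%N then (row_len la 1 <= q)%N
  else has_box la p q && ~~ has_box la p.+1 q.+1.

Notation Hn R n := {ffun 'S_n -> (R[i])^o}.

Section ComplexNumbers.
Variable R : realType.
Local Notation C := R[i].

(** * Irreducible representations and characters of S(n) *)

(** pi^la is the Specht module of la: the submodule of the regular
    representation generated by the Young symmetrizer of the row-reading
    tableau, whose k-th entry is in row [reshape_index la k] and column
    [reshape_offset la k] (numbered from 0). *)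
Section Specht.
Variables (n : nat) (la : seq nat).
Local Notation regG := (regular_repr C [set: 'S_n]%G).

Definition row_group : {set 'S_n} :=
  [set s : 'S_n | [forall k, reshape_index la (s k) == reshape_index la k]]%SET.

Definition col_group : {set 'S_n} :=
  [set s : 'S_n | [forall k, reshape_offset la (s k) == reshape_offset la k]]%SET.

Definition young_symmetrizer : 'rV[C]_#|[set: 'S_n]%G| :=
  \sum_(r in row_group) \sum_(c in col_group)
     (-1) ^+ c *: gring_row (regG (r * c)%g).

Definition specht_mx := cyclic_mx regG young_symmetrizer.

Definition irr_repr : mx_representation C [set: 'S_n]%G (\rank specht_mx) :=
  submod_repr (cyclic_mx_module regG young_symmetrizer).

End Specht.

(** * The spaces H^n and the regular representations *)

Definition Hn_dot n (f g : Hn R n) : C :=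
  (n`!%:R)^-1 * \sum_(x : 'S_n) f x * (g x)^*.

Definition Reg n (g : 'S_n * 'S_n) (f : Hn R n) : Hn R n :=
  [ffun x => f (g.1 * x * g.2^-1)%g].

Definition Lz (z : C) n (f : Hn R n) : Hn R n.+1 :=
  [ffun x : 'S_n.+1 => (if x ord_max == ord_max then z else 1) *
     sqrtC (n.+1%:R / (`|z| ^+ 2 + n%:R)) * f (proj x)].

Definition chi n (la : seq nat) : Hn R n := [ffun x => \tr (irr_repr n la x)].

(** The external tensor square pi^la x pi^la, realized on matrices (the
    tensor u (x) w is [u^T *m w]). *)
Definition tensor_act n (la : seq nat) (g : 'S_n * 'S_n)
    (A : 'M[C]_(\rank (specht_mx n la))) : 'M[C]_(\rank (specht_mx n la)) :=
  (irr_repr n la g.1)^T *m A *m irr_repr n la g.2.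

(** H(la) is the subspace of Reg^n carrying pi^la x pi^la, i.e., the union of
    the images of the intertwining operators from pi^la x pi^la to Reg^n
    (a subspace since the multiplicity is one). *)
Definition H_la n (la : seq nat) : set (Hn R n) :=
  [set f | exists (phi : {linear 'M[C]_(\rank (specht_mx n la)) -> Hn R n}) A,
     (forall g B, phi (tensor_act g B) = Reg g (phi B)) /\ f = phi A].

(** * The representation T_z *)

Section InductiveLimit.
Variables (z : C) (V : completeNormedModType C).
Variable dot : {dot V for Num.conj}.
Variable j : forall n, {linear Hn R n -> V}.
Variable T : (Sinf * Sinf)%type -> {linear V -> V}.

Definition unitary_representation :=
  [/\ T 1%g =1 id,
      forall g h, T (g * h)%g =1 T g \o T h &
      forall g u v, dot (T g u) (T g v) = dot u v].

(** [V], with inner product [dot], is the Hilbert completion H of the union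
    of the chain H^1 -> H^2 -> ... of isometric embeddings [Lz z], [j n]
    (n >= 1) being the embedding of H^n into H, and [T] is the unitary
    representation T_z.  Up to a unique unitary equivalence these data are
    determined by [z]; [j 0] plays no role. *)
Record is_Tz : Prop := IsTz {
  Tz_norm : forall v : V, `|v| ^+ 2 = dot v v;
  Tz_isometry : forall n, (0 < n)%N ->
    forall f g : Hn R n, dot (j n f) (j n g) = Hn_dot f g;
  Tz_compat : forall n, (0 < n)%N ->
    forall f : Hn R n, j n.+1 (Lz z f) = j n f;
  Tz_dense : dense [set v | exists2 n, (0 < n)%N & range (j n) v];
  Tz_unitary : unitary_representation;
  Tz_Reg : forall n, (0 < n)%N -> forall (g : 'S_n * 'S_n) (f : Hn R n),
    T (emb g.1, emb g.2) (j n f) = j n (Reg g f) }.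

Definition xi n (la : seq nat) : V := j n (chi n la).

(** The algebraic sum of the H(la), la in Y_n and Y(p, q), consists of the
    finite sums of elements of these subspaces. *)
Definition H_block (p q : nat) : set V :=
  closure [set v | exists n (s : seq (seq nat)) (F : seq nat -> Hn R n),
    [/\ (0 < n)%N,
        {in s, forall la, [/\ young_diagram n la, in_Y p q la
                            & H_la la (F la)]} &
        v = j n (\sum_(la <- s) F la)]].

Definition K_invariant (v : V) := forall s : Sinf, T (s, s) v = v.

End InductiveLimit.

(** * The function f_pq *)

Definition lam_plus (q : nat) (la : seq nat) (i : nat) : int :=
  (row_len la i)%:Z - q%:Z.
Definition lam_minus (p : nat) (la : seq nat) (l : nat) : int :=
  (col_len la l)%:Z - p%:Z.

(** The natural number subtractions are exact for n >= 1. *)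
Definition f_pq (p q n : nat) (la : seq nat) : C :=
  (-1) ^ (\sum_(1 <= l < q.+1) lam_minus p la l)
  * (sqrtC ((`|p%:Z - q%:Z| ^ 2 + n - 1)%N`! * n`!)%:R
     / ((p ^ 2 + q ^ 2 - p * q + n - 1)%N`!)%:R)
  * (\prod_(1 <= i < p.+1) \prod_(i.+1 <= l < p.+1)
       (lam_plus q la i - lam_plus q la l + l%:Z - i%:Z))%:~R
  * (\prod_(1 <= r < q.+1) \prod_(r.+1 <= s < q.+1)
       (lam_minus p la r - lam_minus p la s + s%:Z - r%:Z))%:~R.

End ComplexNumbers.

(* Main.v *)
Require Import Defs.
From HB Require Import structures.
From mathcomp Require Import all_boot all_order all_algebra all_fingroup.
From mathcomp Require Import mxrepresentation complex.
From mathcomp Require Import all_classical all_reals all_analysis.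
From mathcomp Require Import zify ring lra.
Import Order.TTheory GRing.Theory Num.Theory.
Import numFieldNormedType.Exports.
Set Implicit Arguments.
Unset Strict Implicit.
Unset Printing Implicit Defensive.
Local Open Scope ring_scope.

(* A K-invariant vector v with (v, xi_la) = f la exists as soon as f
   is coherent (f la is the pairing of the family f at level n + 1 with
   L xi_la) and the sums of |f la|^2 over the diagrams with n boxes are
   bounded: the vectors v_n = sum_la f la xi_la are then the successive
   projections of one another, with bounded norms, hence converge.

   The adjoint of L sends chi^mu to
     ((n + 1) (|z|^2 + n))^(-1/2) * sum_(la = mu - box) (conj z + content) chi^la.
   This follows from the branching rule and its Jucys-Murphy refinement, which
   are read off Frobenius' formula: in terms of power sums, fixing the point
   n + 1 is the multiplication by p_1, and inserting it in all possible ways in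
   the cycles is the derivation sum_a t_a^2 d/dt_a.  To identify the characters
   of the Specht modules with the functions psi given by Frobenius' formula, one
   checks that both have norm 1 (by Jacobi-Trudi and by von Neumann's lemma) and
   that their inner product is 1 (the words fixed by row and column
   permutations satisfy a dominance condition).

   For f = f_pq, coherence splits into the identity
     sum_i (x_i + 1) V(x + e_i) = (sum_i x_i + m (m + 1) / 2) V(x)
   for the Vandermonde product V in m variables, applied to the rows and to
   the columns; the factor p - q + content kills the boxes leaving Y(p, q). *)

(** * Words fixed by a permutation *)

(** [chi] is the trace on a Specht module, whose restriction to a smaller symmetric group is not
    visible from the Young symmetrizer; the coefficients in Frobenius' formula, on the contrary,
    obey the branching rules for any exponents. The symmetrizer does give inner products, whence the
    detour: the two functions are real, so norms 1 and inner product 1 make the norm of their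
    difference 0. The constants of [f_pq] come from coherence. The Vandermonde identities for the p
    rows and the q columns contribute p (p - q) and q^2 besides the number n of boxes, so the
    Vandermonde part is multiplied by p^2 + q^2 - p q + n, and the quotient of factorials is the
    solution of the resulting recursion in n. Boundedness leaves no power of n to spare. The squared
    Vandermonde part grows like n to the power p (p - 1) + q (q - 1), and there are of the order of
    n to the power p + q - 1 diagrams; the squared prefactor decays with exponent p^2 + q^2 - 1,
    exactly the sum of the two. *)

Definition plift n (y : 'S_n) : 'S_n.+1 := lift_perm ord_max ord_max y.

Lemma plift_max n (y : 'S_n) : plift y ord_max = ord_max.
Proof. exact: lift_perm_id. Qed.

Lemma plift_lift n (y : 'S_n) i :
  plift y (lift ord_max i) = lift ord_max (y i).
Proof. exact: lift_perm_lift. Qed.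

Lemma mul_plift_tperm_max n (y : 'S_n) k :
  (plift y * tperm k ord_max)%g ord_max = k.
Proof. by rewrite permM plift_max tpermR. Qed.

Lemma proj_mul_plift n (y : 'S_n) k :
  Defs.proj (plift y * tperm k ord_max)%g = y.
Proof.
apply/permP => i; apply: (@lift_inj _ ord_max).
rewrite permE proj_fun_lift mul_plift_tperm_max permM plift_lift.
case: tpermP => [<-|/eqP|_].
- by rewrite eqxx.
- by rewrite eq_sym (negPf (neq_lift _ _)).
- by move/eqP/negPf; rewrite eq_sym (negPf (neq_lift _ _)).
Qed.

Lemma mul_plift_proj n (x : 'S_n.+1) :
  (plift (Defs.proj x) * tperm (x ord_max) ord_max)%g = x.
Proof.
apply/permP => i; case: (unliftP ord_max i) => [i'|] ->; last first.
  by rewrite mul_plift_tperm_max.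
rewrite permM plift_lift [Defs.proj x _]permE proj_fun_lift.
case: eqP => [->|/eqP ne]; first exact: tpermL.
rewrite tpermD // 1?eq_sym //.
by rewrite (inj_eq perm_inj) eq_sym neq_lift.
Qed.

(** The fibre of [proj] over [y]: the point n + 1 is inserted in its cycle just before [k], or is
    fixed when [k] is [ord_max]. *)
Lemma sum_permS (V : nmodType) n (F : 'S_n.+1 -> V) :
  \sum_x F x = \sum_(y : 'S_n) \sum_k F (plift y * tperm k ord_max)%g.
Proof.
rewrite pair_big /=.
rewrite (reindex (fun yk : 'S_n * 'I_n.+1 =>
  (plift yk.1 * tperm yk.2 ord_max)%g)) //=.
exists (fun x => (Defs.proj x, x ord_max)) => [[y k] _|x _] /=.
  by rewrite proj_mul_plift mul_plift_tperm_max.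
exact: mul_plift_proj.
Qed.

Section Words.
Variable A : finType.

Definition fixed_word n (x : 'S_n) (f : {ffun 'I_n -> A}) :=
  [forall i, f (x i) == f i].

Definition wcontent n (f : {ffun 'I_n -> A}) : {ffun A -> nat} :=
  [ffun a => \sum_i (f i == a)%N]%N.

Definition incr (M : {ffun A -> nat}) b : {ffun A -> nat} :=
  [ffun a => M a + (b == a)]%N.

Definition ext_word n (f : {ffun 'I_n -> A}) a : {ffun 'I_n.+1 -> A} :=
  [ffun i => if unlift ord_max i is Some k then f k else a].

Lemma ext_word_max n (f : {ffun 'I_n -> A}) a : ext_word f a ord_max = a.
Proof. by rewrite ffunE unlift_none. Qed.

Lemma ext_word_lift n (f : {ffun 'I_n -> A}) a i :
  ext_word f a (lift ord_max i) = f i.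
Proof. by rewrite ffunE liftK. Qed.

Lemma wcontent_ext n (f : {ffun 'I_n -> A}) a :
  wcontent (ext_word f a) = incr (wcontent f) a.
Proof.
apply/ffunP => b; rewrite !ffunE (bigD1_ord ord_max) //= ext_word_max addnC.
by congr (_ + _)%N; apply: eq_bigr => i _; rewrite ext_word_lift.
Qed.

Lemma sum_wcontent n (f : {ffun 'I_n -> A}) : (\sum_a wcontent f a)%N = n.
Proof.
under eq_bigr do rewrite ffunE.
rewrite exchange_big /= -[RHS]card_ord -sum1_card; apply: eq_bigr => i _.
by rewrite (bigD1 (f i)) //= eqxx big1 // => a /negPf; rewrite eq_sym => ->.
Qed.

Lemma sum_ext_word (V : nmodType) n (F : {ffun 'I_n.+1 -> A} -> V) :
  \sum_f F f = \sum_f \sum_a F (ext_word f a).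
Proof.
rewrite pair_big /=.
rewrite (reindex (fun fa : {ffun 'I_n -> A} * A => ext_word fa.1 fa.2)) //=.
exists (fun f => ([ffun i => f (lift ord_max i)], f ord_max))
  => [[f a] _|f _] /=.
  rewrite ext_word_max; congr (_, _).
  by apply/ffunP => i; rewrite ffunE ext_word_lift.
apply/ffunP => i; case: (unliftP ord_max i) => [i'|] ->.
  by rewrite ext_word_lift ffunE.
by rewrite ext_word_max.
Qed.

(** A fixed word is constant on cycles, so the inserted point must carry the letter at [k]; once it
    does, composing with the transposition no longer changes the word. *)
Lemma fixed_ext_word n (y : 'S_n) k (f : {ffun 'I_n -> A}) a :
  fixed_word (plift y * tperm k ord_max)%g (ext_word f a) =
  fixed_word y f && (a == ext_word f a k).
Proof.
apply/forallP/andP => [fx|[/forallP fy /eqP ak] i]; last first.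
  have ft l : ext_word f a (tperm k ord_max l) = ext_word f a l.
    by case: tpermP => // ->; rewrite -?ak ext_word_max.
  rewrite permM ft; case: (unliftP ord_max i) => [i'|] ->.
    by rewrite plift_lift !ext_word_lift.
  by rewrite plift_max.
have ak : ext_word f a k = a.
  by move/(_ ord_max)/eqP: fx; rewrite mul_plift_tperm_max ext_word_max.
have ft l : ext_word f a (tperm k ord_max l) = ext_word f a l.
  by case: tpermP => // ->; rewrite ?ak ext_word_max.
split; last by rewrite ak.
apply/forallP => i; move/(_ (lift ord_max i)): fx.
by rewrite permM ft plift_lift !ext_word_lift.
Qed.

(** The fixed words are the monomials in the expansion of the power sum of the cycle type of [x];
    [W] is an arbitrary linear functional evaluated on them. *)
Definition wsum (V : nmodType) n (x : 'S_n) (W : {ffun A -> nat} -> V) : V :=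
  \sum_(f | fixed_word x f) W (wcontent f).

Lemma eq_wsum (V : nmodType) n (x : 'S_n) (W W' : {ffun A -> nat} -> V) :
  W =1 W' -> wsum x W = wsum x W'.
Proof. by move=> E; apply: eq_bigr => f _. Qed.

Lemma wsum_plift (V : nmodType) n (y : 'S_n) (W : {ffun A -> nat} -> V) :
  wsum (plift y) W = wsum y (fun M => \sum_b W (incr M b)).
Proof.
rewrite /wsum big_mkcond sum_ext_word [RHS]big_mkcond /=.
apply: eq_bigr => f _; have [fy|fy] := boolP (fixed_word y f).
  apply: eq_bigr => a _.
  have := fixed_ext_word y ord_max f a.
  by rewrite tperm1 mulg1 ext_word_max eqxx fy => ->; rewrite wcontent_ext.
apply: big1 => a _; have := fixed_ext_word y ord_max f a.
by rewrite tperm1 mulg1 (negPf fy) => ->.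
Qed.

(** The weight [(M b).+1] combines the derivation, which gives [M b] (one for each [k] with letter
    [b]), and multiplication by p_1, which is the term [k = ord_max]. *)
Lemma sum_wsum_plift (V : nmodType) n (y : 'S_n) (W : {ffun A -> nat} -> V) :
  \sum_k wsum (plift y * tperm k ord_max)%g W =
  wsum y (fun M => \sum_b W (incr M b) *+ (M b).+1).
Proof.
rewrite /wsum; under eq_bigr do rewrite big_mkcond sum_ext_word.
rewrite exchange_big [RHS]big_mkcond /=.
apply: eq_bigr => f _; rewrite exchange_big /=.
under eq_bigr do under eq_bigr do rewrite fixed_ext_word wcontent_ext.
case: (fixed_word y f) => /=; last by rewrite big1 // => a _; rewrite big1.
apply: eq_bigr => a _; under eq_bigr do rewrite -mulrb.
rewrite sumrMnr; congr (_ *+ _); rewrite (bigD1_ord ord_max) //=.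
rewrite ext_word_max eqxx ffunE add1n; congr _.+1.
by apply: eq_bigr => i _; rewrite ext_word_lift eq_sym.
Qed.

(** Contents of total n take values below any [L > n]; bounding them makes the set of contents a
    finite type. *)
Definition natf L (M : {ffun A -> 'I_L}) : {ffun A -> nat} :=
  [ffun a => M a : nat].

Lemma sum_incr (V : nmodType) L n (W : {ffun A -> nat} -> V) b :
  (n.+1 < L)%N ->
  \sum_(M : {ffun A -> 'I_L} | (\sum_a M a)%N == n)
     W (incr (natf M) b) *+ (M b).+1 =
  \sum_(M : {ffun A -> 'I_L} | (\sum_a M a)%N == n.+1) W (natf M) *+ M b.
Proof.
case: L => // L nL.
pose up (M : {ffun A -> 'I_L.+1}) : {ffun A -> 'I_L.+1} :=
  [ffun a => if a == b then inord (M a).+1 else M a].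
pose dn (M : {ffun A -> 'I_L.+1}) : {ffun A -> 'I_L.+1} :=
  [ffun a => if a == b then inord (M a).-1 else M a].
rewrite [RHS](bigID (fun M : {ffun A -> 'I_L.+1} => 0 < M b)%N) /=.
rewrite [X in _ = _ + X]big1 ?addr0; last first.
  by move=> M /andP[_]; rewrite -eqn0Ngt => /eqP ->.
have leM (M : {ffun A -> 'I_L.+1}) : (M b <= \sum_a M a)%N.
  by rewrite (bigD1 b) //= leq_addr.
rewrite [RHS](reindex_onto up dn) /=; last first.
  move=> M /andP[_ Mb]; apply/ffunP => a; rewrite !ffunE; case: eqP => // ->.
  by apply: val_inj; rewrite /= !inordK ?prednK // ltnW.
have upE (M : {ffun A -> 'I_L.+1}) :
    (\sum_a M a)%N = n -> natf (up M) = incr (natf M) b.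
  move=> Mn; apply/ffunP => a; rewrite !ffunE eq_sym.
  case: eqP => [<-|_]; last by rewrite addn0.
  by rewrite addn1 inordK //; apply: leq_ltn_trans nL; rewrite ltnS -Mn.
have sum_upE (M : {ffun A -> 'I_L.+1}) :
    (\sum_a M a)%N = n -> (\sum_a up M a)%N = n.+1.
  move=> Mn; have E := upE M Mn.
  transitivity (\sum_a incr (natf M) b a)%N.
    by rewrite -E; apply: eq_bigr => a _; rewrite [RHS]ffunE.
  under eq_bigr do rewrite !ffunE.
  rewrite big_split /= Mn (bigD1 b) //= eqxx big1 ?addn0 ?addn1 //.
  by move=> a /negPf; rewrite eq_sym => ->.
apply: eq_big => [M|M /eqP Mn]; last first.
  rewrite upE //; congr (_ *+ _); have /ffunP/(_ b) := upE M Mn.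
  by rewrite !ffunE eqxx addn1 => ->.
apply/idP/idP => [/eqP Mn|].
  rewrite sum_upE // eqxx /=.
  have upb : up M b = (M b).+1 :> nat.
    by have /ffunP/(_ b) := upE M Mn; rewrite !ffunE eqxx addn1.
  rewrite upb /=; apply/eqP/ffunP => a; rewrite ffunE.
  case: eqP => [->|ab]; last by rewrite ffunE; case: eqP.
  by rewrite upb /= inord_val.
case/andP=> /andP[/eqP s upb] /eqP dnup.
(* The only overflow is at [M b = L], where [inord] returns its default [ord0]; then [dn (up M)] is
   0 at [b], which [dnup] excludes. *)
have MbL : ((M b).+1 < L.+1)%N.
  rewrite ltnNge; apply/negP => LM.
  have Mb : M b = L :> nat by apply/eqP; rewrite eqn_leq -ltnS ltn_ord.
  move/ffunP/(_ b): dnup; rewrite !ffunE eqxx => /(congr1 val) /=.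
  have -> : (inord (M b).+1 : 'I_L.+1) = ord0.
    by apply: val_inj; rewrite /= /inord /insubd insubF //= Mb ltnn.
  by rewrite /= inordK // Mb => L0; rewrite -L0 in nL.
have : (\sum_a up M a = (\sum_a M a).+1)%N.
  rewrite (bigD1 b) //= [in RHS](bigD1 b) //= ffunE eqxx inordK //.
  rewrite addSn; congr (_ + _).+1; apply: eq_bigr => a /negPf ab.
  by rewrite ffunE ab.
by rewrite s => -[->].
Qed.

(* Each [M] is counted [n`!] times: it is the content of
   [n`! / \prod_a (M a)`!] words, each fixed by [\prod_a (M a)`!]
   permutations. *)
Lemma sum_wsum (V : nmodType) L n (W : {ffun A -> nat} -> V) :
  (n < L)%N ->
  \sum_(x : 'S_n) wsum x W =
  (\sum_(M : {ffun A -> 'I_L} | (\sum_a M a)%N == n) W (natf M)) *+ n`!.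
Proof.
elim: n => [|n IH] in W *.
  move=> L0; rewrite fact0 mulr1n.
  rewrite (big_pred1 1%g) => [|x]; last first.
    by apply/esym/eqP/permP => -[].
  have f0 (f g : {ffun 'I_0 -> A}) : f = g by apply/ffunP => -[].
  pose f1 : {ffun 'I_0 -> A} := ffun0 (card_ord 0).
  rewrite /wsum (big_pred1 f1) => [|f /=]; last first.
    by rewrite (f0 f f1) eqxx; apply/forallP => -[].
  case: L L0 => // L _.
  rewrite (big_pred1 [ffun=> ord0]) => [|M /=].
    congr W; apply/ffunP => a; rewrite !ffunE big1 //; by case.
  rewrite sum_nat_eq0; apply/forallP/eqP => [M0|-> a]; last first.
    by rewrite ffunE.
  by apply/ffunP => a; rewrite ffunE; apply/val_inj/eqP/(M0 a).
move=> nL; rewrite sum_permS; under eq_bigr do rewrite sum_wsum_plift.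
rewrite IH ?(ltnW nL) // factS mulrnA; congr (_ *+ _).
rewrite exchange_big /=.
transitivity (\sum_b \sum_(M : {ffun A -> 'I_L} | (\sum_a M a)%N == n.+1)
     W (natf M) *+ M b).
  apply: eq_bigr => b _; rewrite -sum_incr //; apply: eq_bigr => M _.
  by rewrite ffunE.
rewrite exchange_big /= -sumrMnl; apply: eq_bigr => M /eqP <-.
by rewrite sumrMnr.
Qed.

End Words.

(** * Frobenius' formula *)

Section WsumTheory.
Variable A : finType.
Implicit Types n : nat.

Lemma wsum_sum (V : nmodType) I (r : seq I) (P : pred I) n (x : 'S_n)
    (G : I -> {ffun A -> nat} -> V) :
  wsum x (fun M => \sum_(b <- r | P b) G b M) =
  \sum_(b <- r | P b) wsum x (G b).
Proof. exact: exchange_big. Qed.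

Lemma mulr_wsumr (F : pzRingType) n (x : 'S_n) c (W : {ffun A -> nat} -> F) :
  c * wsum x W = wsum x (fun M => c * W M).
Proof. exact: mulr_sumr. Qed.

Lemma wsum_perm (V : nmodType) n (x : 'S_n) (t : {perm A})
    (W : {ffun A -> nat} -> V) :
  wsum x (fun M => W [ffun a => M (t a)]) = wsum x W.
Proof.
pose h (f : {ffun 'I_n -> A}) : {ffun 'I_n -> A} := [ffun i => t (f i)].
have h_inj : injective h.
  move=> f g /ffunP E; apply/ffunP => i.
  by apply: (@perm_inj _ t); have := E i; rewrite !ffunE.
rewrite /wsum (reindex_inj h_inj) /=; apply: eq_big => [f|f _].
  by apply: eq_forallb => i; rewrite !ffunE (inj_eq perm_inj).
congr W; apply/ffunP => a; rewrite !ffunE.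
by apply: eq_bigr => i _; rewrite !ffunE (inj_eq perm_inj).
Qed.

End WsumTheory.

(** A pair of fixed words is a fixed word of pairs: power sums in two sets of variables multiply to
    the power sum in the products t_a u_b, as in Cauchy's identity. *)
Lemma wsum_pair (F : pzRingType) (A B : finType) n (x : 'S_n)
    (f : {ffun A -> nat} -> F) (g : {ffun B -> nat} -> F) :
  wsum x f * wsum x g =
  wsum x (fun M : {ffun A * B -> nat} =>
    f [ffun a => \sum_b M (a, b)]%N * g [ffun b => \sum_a M (a, b)]%N).
Proof.
rewrite /wsum big_distrlr pair_big /=.
pose h (w : {ffun 'I_n -> A * B}) :=
  ([ffun i => (w i).1] : {ffun 'I_n -> A}, [ffun i => (w i).2] : {ffun 'I_n -> B}).
rewrite (reindex h) /=; last first.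
  exists (fun p : {ffun 'I_n -> A} * {ffun 'I_n -> B} =>
      [ffun i => (p.1 i, p.2 i)]) => [w _|[u v] _].
    by apply/ffunP => i; rewrite !ffunE -surjective_pairing.
  by congr (_, _); apply/ffunP => i; rewrite !ffunE.
apply: eq_big => [w|w _].
  apply/andP/forallP => [[/forallP w1 /forallP w2] i|xw]; last first.
    by split; apply/forallP => i; rewrite !ffunE (eqP (xw i)).
  have := w1 i; have := w2 i; rewrite !ffunE => /eqP E2 /eqP E1.
  by rewrite [w (x i)]surjective_pairing [w i]surjective_pairing E1 E2.
congr (f _ * g _); apply/ffunP => a; rewrite !ffunE.
  under [RHS]eq_bigr do rewrite ffunE.
  rewrite exchange_big /=; apply: eq_bigr => i _; rewrite ffunE.
  rewrite (bigD1 (w i).2) //= -pair_eqE /= eqxx andbT big1 ?addn0 // => b.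
  by rewrite eq_sym => /negPf ->; rewrite andbF.
under [RHS]eq_bigr do rewrite ffunE.
rewrite exchange_big /=; apply: eq_bigr => i _; rewrite ffunE.
rewrite (bigD1 (w i).1) //= -pair_eqE /= eqxx big1 ?addn0 // => b.
by rewrite eq_sym => /negPf ->.
Qed.

(** Terms are paired off instead of deducing S = 0 from S = - S, so no division by 2 is required of
    the ring. *)
Lemma sign_cancel (F : pzRingType) (T : finType) (sg : T -> bool)
    (P : pred T) (h : T -> T) (G : T -> F) :
  involutive h -> (forall w, P (h w) = P w) ->
  (forall w, P w -> sg (h w) = ~~ sg w) -> (forall w, P w -> G (h w) = G w) ->
  \sum_(w | P w) (-1) ^+ sg w * G w = 0.
Proof.
move=> hK hP hsg hG; rewrite (bigID sg) /=.
rewrite [X in _ + X](reindex_inj (inv_inj hK)) /=.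
rewrite [X in _ + X](eq_bigl (fun w => P w && sg w)); last first.
  by move=> w; rewrite hP; case Pw: (P w) => //=; rewrite hsg // negbK.
rewrite -big_split big1 //= => w /andP[Pw sw].
by rewrite hsg // hG // sw expr0 expr1 mul1r mulN1r addNr.
Qed.

Section Psi.
Variables (F : comNzRingType) (N : nat).
Implicit Types (b : 'I_N -> nat) (M : {ffun 'I_N -> nat}) (w : 'S_N).

Definition fits w b M := [forall a, M a + rev_ord (w a) == b a]%N.

(* The coefficient of [\prod_a t_a ^ b a] in the product of the Vandermonde
   determinant [\sum_w sgn(w) \prod_a t_a ^ (N - 1 - w a)] with the power sum
   of cycle type that of [x]; the exponents are counted by the words fixed by
   [x]. *)
Definition psi b n (x : 'S_n) : F :=
  \sum_(w : 'S_N) (-1) ^+ w * wsum x (fun M => (fits w b M)%:R).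

Definition decr b c : 'I_N -> nat := fun a => (b a - (c == a))%N.

Lemma fits_incr w b M c : fits w b (incr M c) = (0 < b c)%N && fits w (decr b c) M.
Proof.
apply/forallP/andP => [H|[bc /forallP H] a].
  have bc : (0 < b c)%N.
    by have /eqP <- := H c; rewrite ffunE eqxx addn1.
  split=> //; apply/forallP => a; have /eqP := H a; rewrite ffunE /decr => <-.
  by rewrite addnAC addnK.
have /eqP := H a; rewrite ffunE /decr; case: eqP => [<-|_] E; apply/eqP.
  by move: bc E => /=; lia.
by move: E => /=; lia.
Qed.

Lemma psi_plift b n (y : 'S_n) :
  psi b (plift y) = \sum_(c | (0 < b c)%N) psi (decr b c) y.
Proof.
rewrite /psi exchange_big /=; apply: eq_bigr => w _.
rewrite wsum_plift wsum_sum mulr_sumr [RHS]big_mkcond /=.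
apply: eq_bigr => c _; case: ifP => bc; last first.
  rewrite /wsum big1 ?mulr0 // => f _.
  by rewrite fits_incr bc.
by congr (_ * _); apply: eq_wsum => M; rewrite fits_incr bc.
Qed.

(** Antisymmetry in the exponents. It removes from the branching sums the rows from which no box can
    be taken. *)
Lemma psi_eq0 b (a c : 'I_N) n (x : 'S_n) : a != c -> b a = b c -> psi b x = 0.
Proof.
move=> ac bac; pose t := tperm a c.
apply: (@sign_cancel _ _ _ _ (fun w => t * w)%g) => //.
- by move=> w; rewrite mulgA tperm2 mul1g.
- by move=> w _; rewrite odd_permM odd_tperm ac.
move=> w _; rewrite -[LHS](wsum_perm x t).
apply: eq_wsum => M; congr (nat_of_bool _)%:R.
have bt d : b (t d) = b d by rewrite /t; case: tpermP => // ->.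
rewrite /fits; apply/forallP/forallP => H d.
  by have := H (t d); rewrite ffunE permM /t !tpermK -/t bt.
by have := H (t d); rewrite ffunE permM bt.
Qed.

(* Swapping the values [k] and [k - 1] of [w] cancels these terms in pairs. *)
Lemma sum_fits_incr_eq0 b M :
  \sum_(w : 'S_N) \sum_c (-1) ^+ w * ((fits w b (incr M c))%:R *+ w c) = 0 :> F.
Proof.
transitivity (\sum_(w : 'S_N) \sum_k
   (-1) ^+ w * ((fits w b (incr M (w^-1 k)%g))%:R *+ k) : F).
  apply: eq_bigr => w _; rewrite (reindex_inj (@perm_inj _ w^-1%g)) /=.
  by apply: eq_bigr => k _; rewrite permKV.
rewrite exchange_big big1 //= => k _.
have [->|k0] := posnP k; first by rewrite big1 // => w _; rewrite mulr0n mulr0.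
have k1N : (k.-1 < N)%N by rewrite (leq_ltn_trans (leq_pred _)).
pose k' := Ordinal k1N; pose t := tperm k k'.
have kk' : k != k' by rewrite -val_eqE /=; lia.
apply: (@sign_cancel _ _ _ _ (fun w => w * t)%g) => //.
- by move=> w; rewrite -mulgA tperm2 mulg1.
- by move=> w _; rewrite odd_permM odd_tperm kk' addbT.
move=> w _; congr ((nat_of_bool _)%:R *+ _); rewrite /fits; apply: eq_forallb => d.
rewrite !ffunE invMg !permM tpermV tpermL; congr (_ == _).
have E (v : 'S_N) l : (v^-1%g l == d) = (v d == l).
  by apply/eqP/eqP => <-; rewrite ?permK ?permKV.
rewrite !E -!addnA; congr (_ + _)%N => /=.
have := ltn_ord k; rewrite /t; case: tpermP => [->|->|/eqP n1 /eqP n2].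
- by rewrite eqxx (negPf kk') /= ; lia.
- by rewrite eqxx eq_sym (negPf kk') /= ; lia.
- by rewrite (negPf n1) (negPf n2).
Qed.

(** For [b c = mu c + N.-1 - c] the factor is [mu c - c], that is 1 plus the content of the last box
    of row [c]; the 1 comes from [k = ord_max]. *)
Lemma sum_psi_plift b n (y : 'S_n) :
  \sum_k psi b (plift y * tperm k ord_max)%g =
  \sum_(c | (0 < b c)%N) ((b c)%:R - N.-1%:R) * psi (decr b c) y.
Proof.
rewrite /psi exchange_big /=.
under eq_bigr do rewrite -mulr_sumr sum_wsum_plift mulr_wsumr.
under [RHS]eq_bigr do rewrite mulr_sumr.
rewrite [RHS]big_mkcond /= /wsum exchange_big /=.
transitivity (\sum_(f : {ffun 'I_n -> 'I_N} | fixed_word y f)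
    \sum_(w : 'S_N) \sum_c (-1) ^+ w * ((fits w b (incr (wcontent f) c))%:R
       * ((b c)%:R - N.-1%:R)) : F).
  apply: eq_bigr => f _.
  (* Where [fits] holds, the weight is M c + 1 = b c - (N - 1) + w c, and the sum of the parts with
     [w c] is the vanishing sum added here. *)
  transitivity (\sum_(w : 'S_N) (\sum_c (-1) ^+ w *
       ((fits w b (incr (wcontent f) c))%:R * ((b c)%:R - N.-1%:R)) +
     \sum_c (-1) ^+ w * ((fits w b (incr (wcontent f) c))%:R *+ w c)) : F);
    last by rewrite big_split /= sum_fits_incr_eq0 addr0.
  apply: eq_bigr => w _; rewrite mulr_sumr -big_split /=.
  apply: eq_bigr => c _; rewrite -mulrDr; congr (_ * _).
  case: (boolP (fits _ _ _)) => [/forallP/(_ c)/eqP|_]; last first.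
    by rewrite mul0r !mul0rn addr0.
  rewrite ffunE eqxx mul1r => <-.
  rewrite -[LHS]/((wcontent f c).+1%:R) -[X in _ = _ + X]/((w c)%:R).
  rewrite addrAC; apply/esym/eqP; rewrite subr_eq -!natrD; apply/eqP.
  by congr (_%:R) => /=; have := ltn_ord (w c); lia.
under [LHS]eq_bigr => f _ do rewrite exchange_big /=.
rewrite exchange_big /=; apply: eq_bigr => c _; case: ifP => bc; last first.
  by rewrite big1 // => f _; rewrite big1 // => w _; rewrite fits_incr bc mul0r mulr0.
rewrite exchange_big /=; apply: eq_bigr => w _; rewrite !mulr_sumr.
apply: eq_bigr => f _; rewrite fits_incr bc /=.
by rewrite mulrA mulrC.
Qed.

End Psi.

Lemma rmorph_psi (F F' : comNzRingType) (h : {rmorphism F -> F'}) N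
    (b : 'I_N -> nat) n (x : 'S_n) : h (psi F b x) = psi F' b x.
Proof.
rewrite /psi rmorph_sum; apply: eq_bigr => w _.
rewrite rmorphM rmorph_sign rmorph_sum; congr (_ * _).
by apply: eq_bigr => f _; rewrite rmorph_nat.
Qed.

(** * Orthonormality of the functions psi *)

Section Orthogonality.
Variables (F : comNzRingType) (N L : nat) (u : 'I_N -> F).
Implicit Types (b : 'I_N -> nat).

Definition power_sum n (x : 'S_n) : F :=
  wsum x (fun M : {ffun 'I_N -> nat} => \prod_b u b ^+ M b).

Definition vdm : F := \sum_(w : 'S_N) (-1) ^+ w * \prod_b u b ^+ rev_ord (w b).

Let geo a : {poly F} := \poly_(i < L) u a ^+ i.
(* The generating function of the complete symmetric functions of [u],
   truncated. *)
Let gen_h : {poly F} := \prod_a geo a.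
(** Its coefficients are, up to sign, the elementary symmetric functions of the variables other than
    [u c]. *)
Let elem c : {poly F} := \prod_(a | a != c) (1 - u a *: 'X).

Lemma coef_gen_h d B :
  (gen_h * 'X^d)`_B =
  \sum_(m : {ffun 'I_N -> 'I_L})
     ((\sum_a m a + d)%N == B)%:R * \prod_a u a ^+ m a.
Proof.
rewrite /gen_h; under eq_bigr do rewrite /geo poly_def.
rewrite bigA_distr_bigA /= mulr_suml coef_sum; apply: eq_bigr => m _.
have -> : \prod_i (u i ^+ m i *: 'X^(m i)) =
    (\prod_i u i ^+ m i) *: 'X^(\sum_i m i)%N :> {poly F}.
  elim/big_rec3: _ => [|i p q r _ ->]; first by rewrite expr0 scale1r.
  by rewrite exprD -scalerAl -scalerAr scalerA.
by rewrite -scalerAl -exprD coefZ coefXn mulrC eq_sym.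
Qed.

Lemma size_elem c : (size (elem c) <= N)%N.
Proof.
apply: leq_trans (size_poly_prod_leq _ _) _.
have cN : #|[pred a | a != c]| = N.-1.
  by have := cardC1 c; rewrite card_ord => <-; apply: eq_card => a.
have := ltn_ord c; rewrite cN => c_lt.
apply: (@leq_trans ((\sum_(a : 'I_N | a != c) 2).+1 - N.-1)%N).
  apply: leq_sub2r; rewrite ltnS; apply: leq_sum => a _.
  apply: leq_trans (size_polyD _ _) _.
  rewrite geq_max size_poly1 size_polyN /=.
  by apply: leq_trans (size_scale_leq _ _) _; rewrite size_polyX.
rewrite sum_nat_const cN; lia.
Qed.

(** Modulo ['X^L], each geometric sum is inverse to its factor [1 - u i *: 'X], so only the one for
    [c] survives. *)
Lemma coef_gen_h_elem c B : (B < L)%N -> (gen_h * elem c)`_B = u c ^+ B.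
Proof.
move=> BL; rewrite /gen_h (bigD1 c) //= -mulrA -big_split /=.
have [S ->] : exists S, \prod_(i | i != c) (geo i * (1 - u i *: 'X)) = 1 + 'X^L * S.
  elim/big_rec: _ => [|i p _ [S ->]]; first by exists 0; rewrite mulr0 addr0.
  exists (S - (u i ^+ L)%:P * (1 + 'X^L * S)).
  have -> : geo i * (1 - u i *: 'X) = 1 - (u i ^+ L)%:P * 'X^L.
    rewrite -mul_polyC polyC_exp -exprMn; set y := _ * 'X.
    rewrite -[RHS]opprB subrX1 -[RHS]mulNr opprB mulrC.
    congr (_ * _); rewrite /geo poly_def; apply: eq_bigr => j _.
    by rewrite exprMn -polyC_exp mul_polyC.
  by ring.
rewrite mulrDr mulr1 coefD mulrCA coefXnM BL addr0.
by rewrite coef_poly BL.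
Qed.

Let Hmx b : 'M[F]_N := \matrix_(a, k) (gen_h * 'X^(rev_ord k))`_(b a).
Let Emx : 'M[F]_N := \matrix_(k, c) (elem c)`_(rev_ord k).

(** [Hmx b] is the Jacobi-Trudi matrix of the h_(b_a - (N - 1 - k)); the product reads off the
    coefficient of degree [b a] in [gen_h * elem c], the N coefficients in [Emx] being all those of
    [elem c]. *)
Lemma Hmx_Emx b : (forall a, b a < L)%N ->
  Hmx b *m Emx = \matrix_(a, c) u c ^+ b a.
Proof.
move=> bL; apply/matrixP => a c; rewrite !mxE -(coef_gen_h_elem c (bL a)).
rewrite -[elem c in RHS](coefK) poly_def.
have -> : \sum_(i < size (elem c)) (elem c)`_i *: 'X^i =
    \sum_(i < N) (elem c)`_i *: 'X^i.
  rewrite (big_ord_widen N (fun i => (elem c)`_i *: 'X^i)) ?size_elem //.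
  rewrite big_mkcond /=; apply: eq_bigr => i _; case: ltnP => // le_i.
  by rewrite nth_default ?scale0r.
rewrite (reindex_inj rev_ord_inj) /= mulr_sumr coef_sum.
by apply: eq_bigr => k _; rewrite !mxE rev_ordK -scalerAr coefZ mulrC.
Qed.

(** For the staircase exponents the Jacobi-Trudi matrix has entries h_(k - a), hence is
    unitriangular. *)
Lemma det_Emx : (N <= L)%N -> \det Emx = vdm.
Proof.
move=> NL; pose b (a : 'I_N) : nat := rev_ord a.
have bL a : (b a < L)%N by apply: leq_trans (ltn_ord _) NL.
have /(congr1 determinant) := Hmx_Emx bL; rewrite det_mulmx.
have -> : \det (Hmx b) = 1.
  rewrite -det_tr det_trig; last first.
    apply/is_trig_mxP => i j ij; rewrite !mxE coefMXn /b /=.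
    by rewrite ifT //; have := ltn_ord j; lia.
  rewrite big1 // => i _; rewrite !mxE coefMXn ltnn subnn.
  rewrite /gen_h coef0_prod big1 // => a _; rewrite coef_poly expr0.
  by rewrite (leq_trans _ NL) // (leq_trans _ (ltn_ord i)).
rewrite mul1r => ->; rewrite -det_tr; apply: eq_bigr => w _.
by congr (_ * _); apply: eq_bigr => a _; rewrite !mxE.
Qed.

Lemma sum_curry (I J K : finType) (G : I -> {ffun J -> K} -> F) :
  \sum_(M : {ffun I * J -> K}) \prod_i G i [ffun j => M (i, j)] =
  \prod_i \sum_(m : {ffun J -> K}) G i m.
Proof.
rewrite bigA_distr_bigA /=.
rewrite (reindex (fun M : {ffun I * J -> K} =>
   [ffun i => [ffun j => M (i, j)]] : {ffun I -> {ffun J -> K}})) /=.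
  by apply: eq_bigr => M _; apply: eq_bigr => i _; rewrite ffunE.
exists (fun M : {ffun I -> {ffun J -> K}} => [ffun p => M p.1 p.2]) => M _.
  by apply/ffunP => -[i j]; rewrite !ffunE.
by apply/ffunP => i; apply/ffunP => j; rewrite !ffunE.
Qed.

(* The Jacobi-Trudi identity for the characteristic of [psi b]. *)
Lemma sum_psi_power_sum b n : (n < L)%N -> (N <= L)%N -> (forall a, b a < L)%N ->
  (\sum_a b a = n + \sum_(a < N) rev_ord a)%N ->
  (\sum_(x : 'S_n) psi F b x * power_sum x) * vdm =
  \det (\matrix_(a, c) u c ^+ b a) *+ n`!.
Proof.
move=> nL NL bL sb; rewrite -Hmx_Emx // det_mulmx det_Emx // -mulrnAl.
congr (_ * _); rewrite /psi /power_sum.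
under eq_bigr do rewrite mulr_suml.
rewrite exchange_big /= /determinant -sumrMnl; apply: eq_bigr => w _.
under eq_bigr do rewrite -mulrA wsum_pair.
rewrite -mulr_sumr (sum_wsum _ nL) -mulrnAr; congr (_ * (_ *+ _)).
transitivity (\sum_(M : {ffun 'I_N * 'I_N -> 'I_L})
  (fits w b [ffun a => \sum_c M (a, c)]%N)%:R *
  \prod_c u c ^+ (\sum_a M (a, c))%N).
  rewrite big_mkcond /=; apply: eq_bigr => M _.
  have -> : [ffun a => \sum_b natf M (a, b)]%N = [ffun a => \sum_c M (a, c)]%N.
    by apply/ffunP => a; rewrite !ffunE; apply: eq_bigr => c _; rewrite ffunE.
  have -> : \prod_c u c ^+ [ffun c => \sum_a natf M (a, c)]%N c =
      \prod_c u c ^+ (\sum_a M (a, c))%N.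
    apply: eq_bigr => c _; rewrite ffunE; congr (_ ^+ _).
    by apply: eq_bigr => a _; rewrite ffunE.
  case: eqP => // Mn; case: (boolP (fits _ _ _)) => [/forallP fM|]; last by rewrite mul0r.
  case: Mn; apply/eqP; rewrite -(eqn_add2r (\sum_(a < N) rev_ord a)) -sb.
  apply/eqP.
  under [RHS]eq_bigr => a _ do rewrite -(eqP (fM a)) ffunE.
  rewrite big_split /=; congr (_ + _)%N.
    by rewrite pair_big; apply: eq_bigr => -[a c].
  by rewrite (reindex_inj (@perm_inj _ w)).
transitivity (\sum_(M : {ffun 'I_N * 'I_N -> 'I_L}) \prod_a
  (fun m : {ffun 'I_N -> 'I_L} => ((\sum_c m c + rev_ord (w a))%N == b a)%:R *
     \prod_c u c ^+ m c) [ffun c => M (a, c)]).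
  apply: eq_bigr => M _; rewrite big_split /=; congr (_ * _); last first.
    rewrite exchange_big /=; apply: eq_bigr => c _.
    by rewrite -prodrXr; apply: eq_bigr => a _; rewrite ffunE.
  have sE a : (\sum_c [ffun c => M (a, c)] c)%N = (\sum_c M (a, c))%N.
    by apply: eq_bigr => c _; rewrite ffunE.
  case: (boolP (fits _ _ _)) => [/forallP H|/forallPn[a na]].
    by rewrite big1 // => a _; have := H a; rewrite sE ffunE => ->.
  by rewrite (bigD1 a) //= sE; move: na; rewrite ffunE => /negPf ->; rewrite mul0r.
rewrite (sum_curry (fun a (m : {ffun 'I_N -> 'I_L}) =>
   ((\sum_c m c + rev_ord (w a))%N == b a)%:R * \prod_c u c ^+ m c)).
by apply: eq_bigr => a _; rewrite !mxE coef_gen_h.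
Qed.

End Orthogonality.

(** Kronecker substitution: with the variable of index a replaced by X^(B^a), a monomial with
    exponents below B is recovered from its degree, so univariate polynomials suffice. *)
Definition enc N B (g : 'I_N -> nat) : nat := (\sum_a g a * B ^ a)%N.

Lemma enc_inj N B (f g : 'I_N -> nat) : (forall a, f a < B)%N ->
  (forall a, g a < B)%N -> enc B f = enc B g -> f =1 g.
Proof.
elim: N f g => [|N IH] f g fB gB; first by move=> _ [].
have B0 : (0 < B)%N by apply: leq_ltn_trans (fB ord0).
have E (h : 'I_N.+1 -> nat) :
    enc B h = (enc B (fun a => h (lift ord0 a)) * B + h ord0)%N.
  rewrite /enc big_ord_recl expn0 muln1 addnC big_distrl /=; congr (_ + _)%N.
  by apply: eq_bigr => i _; rewrite /bump /= add1n expnSr mulnA.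
rewrite !E => H; have H0 : f ord0 = g ord0.
  by have /(congr1 (modn^~ B)) := H; rewrite !modnMDl !modn_small.
move: H; rewrite H0 => /addIn/eqP; rewrite eqn_pmul2r // => /eqP/IH H a.
case: (unliftP ord0 a) => [a'|] -> //.
by apply: (H _ _ a') => i; [exact: fB | exact: gB].
Qed.

(** The coefficient of the monomial with exponents [g] is taken in the Jacobi-Trudi identity: on the
    left the power sum times [vdm] yields [psi F g x], on the right the determinant leaves the signs
    of the [s] with [b] equal to [g] composed with [s]. *)
Lemma psi_ortho (F : comNzRingType) N n (b g : 'I_N -> nat) :
  (\sum_a b a = n + \sum_(a < N) rev_ord a)%N ->
  \sum_(x : 'S_n) psi F b x * psi F g x =
  (\sum_(s : 'S_N) (-1) ^+ s * [forall a, b a == g (s a)]%:R) *+ n`!.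
Proof.
(* [B] exceeds all exponents that occur: those of [b] and [g], and the contents (at most n) plus the
   staircase (below N). *)
move=> sb; pose B := (n + N + \sum_a b a + \sum_a g a).+1.
have le_sum (h : 'I_N -> nat) a : (h a <= \sum_a h a)%N.
  by rewrite (bigD1 a) //= leq_addr.
have bB a : (b a < B)%N by have := le_sum b a; rewrite /B; lia.
have gB a : (g a < B)%N by have := le_sum g a; rewrite /B; lia.
have [nB NB] : (n < B)%N /\ (N <= B)%N by rewrite /B; lia.
pose u (c : 'I_N) : {poly F} := 'X^(B ^ c).
have := sum_psi_power_sum u nB NB bB sb.
move=> /(congr1 (fun p : {poly F} => p`_(enc B g))).
rewrite mulr_suml coef_sum => E.
transitivity (\sum_(x : 'S_n)
    (psi {poly F} b x * power_sum u x * vdm u)`_(enc B g)).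
  apply: eq_bigr => x _; rewrite -(rmorph_psi polyC) -mulrA coefCM.
  congr (_ * _); rewrite /vdm mulr_sumr coef_sum; apply: eq_bigr => w _.
  rewrite mulrCA -(rmorph_sign polyC).
  rewrite coefCM; congr (_ * _).
  rewrite /power_sum /wsum mulr_suml coef_sum; apply: eq_bigr => f _.
  rewrite -big_split /=.
  have -> : \prod_i (u i ^+ wcontent f i * u i ^+ rev_ord (w i)) =
      'X^(enc B (fun a => wcontent f a + rev_ord (w a))%N).
    rewrite /enc -prodrXr; apply: eq_bigr => i _.
    by rewrite -exprD /u -exprM mulnC.
  rewrite coefXn; congr (nat_of_bool _)%:R.
  apply/forallP/eqP => [H|/enc_inj H a]; last first.
    apply/eqP; rewrite H // => c.
    have := sum_wcontent f; have := le_sum (wcontent f) c.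
    have := ltn_ord (rev_ord (w c)); rewrite /B; lia.
  by apply: eq_bigr => a _; rewrite (eqP (H a)).
rewrite E coefMn; congr (_ *+ _); rewrite /determinant coef_sum.
apply: eq_bigr => s _; rewrite -(rmorph_sign polyC) coefCM; congr (_ * _).
have -> : \prod_i (\matrix_(a, c) u c ^+ b a) i (s i) =
    'X^(enc B (fun c => b (s^-1 c)%g)).
  rewrite (reindex_inj (@perm_inj _ s^-1%g)) /enc -prodrXr.
  by apply: eq_bigr => i _; rewrite mxE permKV /u -exprM mulnC.
rewrite coefXn; congr (nat_of_bool _)%:R.
apply/eqP/forallP => [/esym/enc_inj H a|H]; last first.
  by apply: eq_bigr => a _; rewrite (eqP (H _)) permKV.
by have /(_ (s a)) := H (fun=> bB _) gB; rewrite permK => ->.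
Qed.

Definition decreasing N (b : 'I_N -> nat) := forall a c : 'I_N, (a < c)%N -> (b c < b a)%N.

Lemma psi_orthonormal (F : comNzRingType) N n (b g : 'I_N -> nat) :
  decreasing b -> decreasing g ->
  (\sum_a b a = n + \sum_(a < N) rev_ord a)%N ->
  \sum_(x : 'S_n) psi F b x * psi F g x = (n`! * [forall a, b a == g a])%:R.
Proof.
move=> db dg sb; rewrite psi_ortho // mulnC natrM mulr_natr; congr (_ *+ _).
rewrite (bigD1 1%g) //= odd_perm1 expr0 mul1r big1 ?addr0 => [|s s1].
  by congr (nat_of_bool _)%:R; apply: eq_forallb => a; rewrite perm1.
case: (boolP [forall a, b a == g (s a)]) => [/forallP H|]; last by rewrite mulr0.
case/eqP: s1; apply/permP => a; rewrite perm1; apply/val_inj.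
(* Since [b] and [g] both decrease, [s] is increasing, hence the identity. *)
have smono (c d : 'I_N) : (c < d)%N -> (s c < s d)%N.
  move=> cd; have := db _ _ cd; rewrite (eqP (H c)) (eqP (H d)) => gcd.
  rewrite ltnNge leq_eqVlt; apply/negP => /orP[/eqP/val_inj/perm_inj E|/dg].
    by rewrite E ltnn in cd.
  by rewrite ltnNge (ltnW gcd).
have low (c : 'I_N) : (c <= s c)%N.
  have [m] := ubnP (val c); elim: m c => // m IH c; rewrite ltnS => cm.
  have [->//|c0] := posnP c.
  have cN : (c.-1 < N)%N by rewrite (leq_ltn_trans (leq_pred _)).
  have c1 : (c.-1 < c)%N by rewrite prednK.
  have /= := IH (Ordinal cN) (leq_trans c1 cm).
  have /= := smono (Ordinal cN) c c1; lia.
have up (c : 'I_N) : (s c <= c)%N.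
  have [m] := ubnP (N - c)%N; elim: m c => // m IH c; rewrite ltnS => cm.
  have [cN|] := ltnP c.+1 N; last by have := ltn_ord (s c); lia.
  have /= := IH (Ordinal cN); have /= := smono c (Ordinal cN) (ltnSn c).
  by have := ltn_ord c; lia.
by apply/eqP; rewrite eqn_leq up low.
Qed.

(** * Young symmetrizers *)

Section KeyStabilizer.
Variables (n : nat) (t : 'I_n -> nat).
Implicit Types s u : 'S_n.

Definition key_stab : {set 'S_n} :=
  [set s : 'S_n | [forall k, t (s k) == t k]]%SET.

Lemma key_stabP s : reflect (forall k, t (s k) = t k) (s \in key_stab).
Proof. by rewrite inE; apply: (iffP forallP) => H k; apply/eqP. Qed.

Lemma key_stab1 : 1%g \in key_stab.
Proof. by apply/key_stabP => k; rewrite perm1. Qed.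

Lemma key_stabM s u : s \in key_stab -> u \in key_stab -> (s * u)%g \in key_stab.
Proof. by move=> /key_stabP sP /key_stabP uP; apply/key_stabP => k; rewrite permM uP. Qed.

Lemma key_stabV s : (s^-1%g \in key_stab) = (s \in key_stab).
Proof.
suff H u : u \in key_stab -> u^-1%g \in key_stab.
  by apply/idP/idP => /H //; rewrite invgK.
by move=> /key_stabP uP; apply/key_stabP => k; rewrite -uP permKV.
Qed.

Lemma key_stabMl s u : s \in key_stab -> ((s * u)%g \in key_stab) = (u \in key_stab).
Proof.
move=> sP; apply/idP/idP; last exact: key_stabM.
by move=> /(key_stabM _) - /(_ s^-1%g); rewrite key_stabV mulKg; apply.
Qed.

Lemma key_stabMr s u : s \in key_stab -> ((u * s)%g \in key_stab) = (u \in key_stab).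
Proof.
by move=> sP; rewrite -[LHS]key_stabV invMg key_stabMl key_stabV.
Qed.

Lemma tperm_key_stab i j : t i = t j -> tperm i j \in key_stab.
Proof. by move=> tij; apply/key_stabP => k; case: tpermP => // ->. Qed.

End KeyStabilizer.

Lemma sum_conjg (V : nmodType) n (h : 'S_n) (G : 'S_n -> V) :
  \sum_x G (h * x * h^-1)%g = \sum_x G x.
Proof.
rewrite [RHS](reindex_inj (mulgI h)) [RHS](reindex_inj (mulIg h^-1%g)) /=.
by apply: eq_bigr => x _; rewrite mulgA.
Qed.

Lemma card_pred_sum (T : finType) (P : pred T) :
  #|[pred k | P k]| = (\sum_k P k)%N.
Proof.
by rewrite -sum1_card big_mkcond; apply: eq_bigr => k _; rewrite inE; case: (P k).
Qed.

Section YoungSymmetrizer.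
Variables (n : nat) (la : seq nat).
Hypothesis la_diag : young_diagram n la.

Local Notation row := (reshape_index la).
Local Notation col := (reshape_offset la).
Local Notation RG := (row_group n la).
Local Notation CG := (col_group n la).

Let la_sum : sumn la = n.
Proof. by case/and3P: la_diag => _ _ /eqP. Qed.

Lemma nth_diagram_le i j : (i <= j)%N -> (nth 0%N la j <= nth 0%N la i)%N.
Proof.
move=> ij; have [js|?] := ltnP j (size la); last by rewrite nth_default.
case/and3P: la_diag => la_s _ _.
have tr : transitive geq by move=> a b c ba ac; apply: leq_trans ac ba.
by apply: (sorted_leq_nth tr leqnn) => //; rewrite inE; apply: leq_ltn_trans ij js.
Qed.

Lemma row_lt (k : 'I_n) : (row k < size la)%N.
Proof. by apply: reshape_indexP; rewrite la_sum. Qed.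

Lemma col_lt_nth (k : 'I_n) : (col k < nth 0%N la (row k))%N.
Proof. by apply: reshape_offsetP; rewrite la_sum. Qed.

Lemma col_lt (k : 'I_n) : (col k < n)%N.
Proof. by apply: leq_ltn_trans (leq_subr _ _) (ltn_ord k). Qed.

Lemma cell_inj (k l : 'I_n) : row k = row l -> col k = col l -> k = l.
Proof.
move=> rkl ckl; apply: val_inj.
by rewrite /= -(reshape_indexK la k) -(reshape_indexK la l) rkl ckl.
Qed.

Lemma cell_exists i j : (j < nth 0%N la i)%N ->
  exists2 k : 'I_n, row k = i & col k = j.
Proof.
move=> ji; have := flatten_indexP ji; rewrite la_sum => kn.
by exists (Ordinal kn); [exact: flatten_indexKl | exact: flatten_indexKr].
Qed.

Lemma row_group_key : RG = key_stab (fun k : 'I_n => row k). Proof. by []. Qed.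
Lemma col_group_key : CG = key_stab (fun k : 'I_n => col k). Proof. by []. Qed.

Lemma row_col_group1 s : s \in RG -> s \in CG -> s = 1%g.
Proof.
rewrite row_group_key col_group_key => /key_stabP sR /key_stabP sC.
by apply/permP => k; rewrite perm1; apply: cell_inj.
Qed.

(** * Words without repeated letters in a column, and dominance *)

Section Words.
Variable N : nat.
Hypothesis la_N : (size la <= N)%N.
Implicit Types f : {ffun 'I_n -> 'I_N}.

Definition row_word : {ffun 'I_n -> 'I_N} :=
  [ffun k => Ordinal (leq_trans (row_lt k) la_N)].

Definition col_inj f := forall i j : 'I_n, col i = col j -> f i = f j -> i = j.

Lemma row_wordE k : row_word k = row k :> nat.
Proof. by rewrite ffunE. Qed.

(** Distinct letters in a column: at most min(m, height) of them are below m, and numbering the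
    boxes by their rows attains this. *)
Lemma col_inj_le f m j : col_inj f ->
  (#|[pred k : 'I_n | (col k == j) && (f k < m)]| <=
   #|[pred k : 'I_n | (col k == j) && (row k < m)]|)%N.
Proof.
move=> f_inj.
have [/forallP all_lt|/forallPn[k]] :=
    boolP [forall k : 'I_n, (col k == j) ==> (row k < m)%N].
  apply: subset_leq_card; apply/fintype.subsetP => k; rewrite !inE => /andP[cj _].
  by rewrite cj (implyP (all_lt k)).
rewrite negb_imply -leqNgt => /andP[/eqP kj mk].
apply: (@leq_trans m).
  rewrite cardE -(size_map (fun k => f k : nat)) -[leqRHS](size_iota 0).
  apply: uniq_leq_size.
    rewrite map_inj_in_uniq ?enum_uniq // => a b; rewrite !mem_enum !inE.
    move=> /andP[/eqP ca _] /andP[/eqP cb _] /val_inj fab.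
    by apply: f_inj; rewrite ?ca ?cb.
  by move=> a /mapP[b]; rewrite mem_enum inE => /andP[_ bm] ->; rewrite mem_iota.
rewrite cardE -(size_map (fun k : 'I_n => row k)) -[leqLHS](size_iota 0).
apply: uniq_leq_size; first exact: iota_uniq.
move=> r; rewrite mem_iota /= add0n => rm.
have [l rl cl] : exists2 l : 'I_n, row l = r & col l = j.
  apply: cell_exists; rewrite -kj; apply: leq_trans (col_lt_nth k) _.
  by apply: nth_diagram_le; apply: leq_trans (ltnW rm) mk.
by apply/mapP; exists l => //; rewrite mem_enum inE cl eqxx rl.
Qed.

Lemma sum_by_col (P : pred 'I_n) :
  (\sum_k P k = \sum_(j < n) #|[pred k : 'I_n | (col k == j) && P k]|)%N.
Proof.
under [RHS]eq_bigr do rewrite -sum1_card big_mkcond /=.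
rewrite exchange_big /=; apply: eq_bigr => k _.
rewrite (bigD1 (Ordinal (col_lt k))) //= inE eqxx /= big1 ?addn0.
  by case: (P k).
by move=> j; rewrite -val_eqE inE /= eq_sym => /negPf ->.
Qed.

Lemma sum_wcontent_lt f m :
  (\sum_(a < N | (a < m)%N) wcontent f a = \sum_k (f k < m))%N.
Proof.
transitivity (\sum_(a < N | (a < m)%N) \sum_k (f k == a))%N.
  by apply: eq_bigr => a _; rewrite ffunE.
rewrite exchange_big /=; apply: eq_bigr => k _.
rewrite big_mkcond (bigD1 (f k)) //= eqxx big1 ?addn0; first by case: ifP.
by move=> a; rewrite eq_sym => /negPf ->; case: ifP.
Qed.

Lemma col_inj_dominated f m : col_inj f ->
  (\sum_(a < N | (a < m)%N) wcontent f a <=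
   \sum_(a < N | (a < m)%N) wcontent row_word a)%N.
Proof.
move=> f_inj; rewrite !sum_wcontent_lt !sum_by_col; apply: leq_sum => j _.
apply: leq_trans (col_inj_le _ _ f_inj) _.
by apply: subset_leq_card; apply/fintype.subsetP => k; rewrite !inE row_wordE.
Qed.

Lemma wcontent_row_word a : wcontent row_word a = nth 0%N la a.
Proof.
rewrite ffunE; transitivity #|[pred k : 'I_n | row k == a]|.
  rewrite card_pred_sum; apply: eq_bigr => k _.
  by rewrite -(inj_eq val_inj) /= row_wordE.
rewrite cardE -(size_map (fun k : 'I_n => col k)) -[RHS](size_iota 0).
apply: perm_size; apply: uniq_perm; last 1 first.
- move=> j; rewrite mem_iota /= add0n; apply/mapP/idP => [[k]|/cell_exists[k rk cj]].
    by rewrite mem_enum inE => /eqP <- ->; apply: col_lt_nth.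
  by exists k => //; rewrite mem_enum inE rk eqxx.
- rewrite map_inj_in_uniq ?enum_uniq // => k l; rewrite !mem_enum !inE.
  by move=> /eqP rk /eqP rl; apply: cell_inj; rewrite rk rl.
exact: iota_uniq.
Qed.

Lemma leq_sum_eq (I : finType) (E1 E2 : I -> nat) :
  (forall i, E1 i <= E2 i)%N -> (\sum_i E1 i = \sum_i E2 i)%N -> E1 =1 E2.
Proof.
move=> le12 eq12 i; apply/eqP; rewrite eqn_leq le12 /=.
have : (\sum_(j | j != i) E1 j <= \sum_(j | j != i) E2 j)%N by apply: leq_sum.
by move: eq12; rewrite (bigD1 i) //= [in RHS](bigD1 i) //=; lia.
Qed.

(** Equal contents mean equality in the sum over the columns of the inequalities [col_inj_le], hence
    in each of them: every column of [f] is a rearrangement of its row numbers. *)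
Lemma col_inj_row_word f : col_inj f -> wcontent f = wcontent row_word ->
  exists2 c, c \in CG & forall k, f k = row_word (c k).
Proof.
move=> f_inj f_cont.
pose nf m j := #|[pred k : 'I_n | (col k == j) && (f k < m)%N]|.
pose nr m j := #|[pred k : 'I_n | (col k == j) && (row k < m)%N]|.
have eqn m j : (j < n)%N -> nf m j = nr m j.
  move=> jn; have := @leq_sum_eq _ (fun j : 'I_n => nf m j) (fun j : 'I_n => nr m j).
  move=> /(_ _ _ (Ordinal jn)); apply=> [i|]; first exact: col_inj_le.
  rewrite /nf /nr -!sum_by_col.
  transitivity (\sum_k (row_word k < m))%N.
    by rewrite -!sum_wcontent_lt f_cont.
  by apply: eq_bigr => k _; rewrite row_wordE.
have split_lt (g : 'I_n -> nat) m j :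
    (#|[pred k : 'I_n | (col k == j) && (g k < m.+1)]| =
     #|[pred k : 'I_n | (col k == j) && (g k < m)]| +
     #|[pred k : 'I_n | (col k == j) && (g k == m)]|)%N.
  rewrite !card_pred_sum -big_split /=; apply: eq_bigr => k _; rewrite ltnS leq_eqVlt.
  by case: (col k == j); case: ltngtP.
(* The counts below m + 1 and below m differ by the number of letters equal to m, so the letter
   [f k] is also a row number in the column of [k]. *)
have exi (k : 'I_n) : exists l : 'I_n, (col l == col k) && (row l == f k).
  have := eqn (f k).+1 _ (col_lt k); rewrite /nf /nr (split_lt (fun k => f k)).
  rewrite (split_lt (fun k => row k)) -/(nf _ _) -/(nr _ _) eqn ?col_lt //.
  move/addnI => E; have : (0 < #|[pred l : 'I_n | (col l == col k) && (f l == f k :> nat)]|)%N.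
    by apply/card_gt0P; exists k; rewrite inE !eqxx.
  by rewrite E => /card_gt0P[l]; rewrite inE; exists l.
pose cf (k : 'I_n) := odflt k [pick l : 'I_n | (col l == col k) && (row l == f k)].
have cfP k : col (cf k) = col k /\ row (cf k) = f k.
  rewrite /cf; case: pickP => [l /andP[/eqP ? /eqP ?] //|no].
  by have [l] := exi k; rewrite no.
have cf_inj : injective cf.
  move=> k l E; apply: f_inj.
    by rewrite -(proj1 (cfP k)) -(proj1 (cfP l)) E.
  by apply: val_inj; rewrite /= -(proj2 (cfP k)) -(proj2 (cfP l)) E.
exists (perm cf_inj).
  by rewrite col_group_key; apply/key_stabP => k; rewrite permE (proj1 (cfP k)).
by move=> k; apply: val_inj; rewrite /= row_wordE permE (proj2 (cfP k)).
Qed.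

Lemma wcontent_comp f (s : 'S_n) : wcontent [ffun k => f (s k)] = wcontent f.
Proof.
apply/ffunP => a; rewrite !ffunE [RHS](reindex_inj (@perm_inj _ s)) /=.
by apply: eq_bigr => k _; rewrite ffunE.
Qed.

End Words.

(** * The symmetrizer as a function on the group, and its character *)

Variable F : numFieldType.

Definition ysym (x : 'S_n) : F :=
  \sum_(r in RG) \sum_(c in CG) (-1) ^+ c * (r * c == x)%g%:R.

Lemma ysym_real x : ysym x \is Num.real.
Proof.
apply: rpred_sum => r _; apply: rpred_sum => c _.
by rewrite rpredMsign realn.
Qed.

Lemma sum_ysym (G : 'S_n -> F) :
  \sum_x ysym x * G x = \sum_(r in RG) \sum_(c in CG) (-1) ^+ c * G (r * c)%g.
Proof.
under eq_bigr do rewrite mulr_suml; rewrite exchange_big; apply: eq_bigr => r _.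
under eq_bigr do rewrite mulr_suml; rewrite exchange_big; apply: eq_bigr => c _.
rewrite (bigD1 (r * c)%g) //= eqxx mulr1 big1 ?addr0 // => x.
by rewrite eq_sym => /negPf ->; rewrite mulr0 mul0r.
Qed.

Lemma ysymMl r x : r \in RG -> ysym (r * x)%g = ysym x.
Proof.
rewrite row_group_key => rR; rewrite /ysym (reindex_inj (mulgI r)) /=.
apply: eq_big => [s|s _]; first by rewrite key_stabMl.
by apply: eq_bigr => c _; rewrite -mulgA (inj_eq (mulgI r)).
Qed.

Lemma ysymMr c x : c \in CG -> ysym (x * c)%g = (-1) ^+ c * ysym x.
Proof.
rewrite col_group_key => cC; rewrite /ysym mulr_sumr; apply: eq_bigr => r _.
rewrite mulr_sumr (reindex_inj (mulIg c)) /=.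
apply: eq_big => [s|s _]; first by rewrite key_stabMr.
by rewrite odd_permM signr_addb mulgA (inj_eq (mulIg c)) mulrA [_ * (-1) ^+ c]mulrC.
Qed.

Lemma ysym1 : ysym 1%g = 1.
Proof.
have R1 : 1%g \in RG by rewrite row_group_key key_stab1.
have C1 : 1%g \in CG by rewrite col_group_key key_stab1.
rewrite /ysym (bigD1 1%g) //= (bigD1 1%g) //= mulg1 eqxx odd_perm1 mulr1.
rewrite big1 => [|c /andP[_ c1]]; last by rewrite mul1g (negPf c1) mulr0.
rewrite big1 ?addr0 // => r /andP[rR r1]; apply: big1 => c cC.
case: eqP => [/eqP|]; last by rewrite mulr0.
rewrite -eq_invg_mul => /eqP rc; case/eqP: r1; apply: row_col_group1 => //.
by rewrite col_group_key -key_stabV rc -col_group_key.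
Qed.

(* Von Neumann's lemma: if [x] is not in [RG * CG], some transposition [t] in
   [RG] satisfies [t x = x t'] with [t'] a transposition in [CG]. *)
Lemma ysym_unique (a : 'S_n -> F) :
  (forall r x, r \in RG -> a (r * x)%g = a x) ->
  (forall c x, c \in CG -> a (x * c)%g = (-1) ^+ c * a x) ->
  forall x, a x = a 1%g * ysym x.
Proof.
move=> aR aC x.
have [/existsP[p /andP[p1 /andP[/eqP rp /eqP cp]]]|/existsPn no] := boolP
  [exists p : 'I_n * 'I_n, [&& p.1 != p.2, row p.1 == row p.2 & col (x p.1) == col (x p.2)]].
  have anti (b : 'S_n -> F) : (forall r x, r \in RG -> b (r * x)%g = b x) ->
      (forall c x, c \in CG -> b (x * c)%g = (-1) ^+ c * b x) -> b x = 0.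
    move=> bR bC; have : b x = - b x.
      rewrite -[LHS](bR (tperm p.1 p.2)); last first.
        by rewrite row_group_key; apply: tperm_key_stab.
      rewrite conjgC tpermJ bC; last by rewrite col_group_key; apply: tperm_key_stab.
      by rewrite odd_tperm (inj_eq perm_inj) p1 expr1 mulN1r.
    by move/eqP; rewrite -addr_eq0 -mulr2n mulrn_eq0 /= => /eqP.
  by rewrite (anti a) // (anti ysym) ?mulr0 //; [exact: ysymMl | exact: ysymMr].
(* The row numbers transported by [x]: without a bad pair no letter repeats in a column, so some [c]
   in [CG] rearranges them into [row_word], which says that [x * c] preserves the rows. *)
pose f : {ffun 'I_n -> 'I_(size la)} :=
  [ffun k => row_word (leqnn (size la)) (x^-1%g k)].
have f_inj : col_inj f.
  move=> i j cij; rewrite !ffunE => /(congr1 val) /= rij.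
  have := no (x^-1%g i, x^-1%g j); rewrite /= !permKV cij rij !eqxx !andbT negbK.
  by move/eqP/perm_inj.
have [c cC fc] := col_inj_row_word f_inj (wcontent_comp _ _).
have xE : x = (x * c * c^-1)%g by rewrite mulgK.
have xcR : (x * c)%g \in RG.
  rewrite row_group_key; apply/key_stabP => k; rewrite permM.
  by have /(congr1 val) := fc (x k); rewrite !ffunE /= permK.
have cVC : c^-1%g \in CG by rewrite col_group_key key_stabV.
rewrite xE aC // ysymMr // -[(x * c)%g]mulg1 aR // ysymMl // ysym1 mulr1.
by rewrite mulrC.
Qed.

(** Coefficient at 1 of the square of the symmetrizer. As [ysym 1%g = 1], it is the scalar by which
    the squared symmetrizer exceeds the symmetrizer. *)
Definition ysq : F := \sum_y ysym y * ysym y^-1%g.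

(** With e the symmetrizer, the left side is the coefficient of [x] in e g e, which has the
    symmetries required by [ysym_unique]. *)
Lemma ysym_sandwich g x :
  \sum_y ysym y * ysym (g^-1 * y^-1 * x)%g =
  (\sum_y ysym y * ysym (g^-1 * y^-1)%g) * ysym x.
Proof.
rewrite (@ysym_unique (fun x => \sum_y ysym y * ysym (g^-1 * y^-1 * x)%g)).
- by congr (_ * _); apply: eq_bigr => y _; rewrite mulg1.
- move=> r {}x rR; rewrite (reindex_inj (mulgI r)) /=; apply: eq_bigr => y _.
  by rewrite ysymMl // invMg !mulgA mulgKV.
- move=> c {}x cC; rewrite mulr_sumr; apply: eq_bigr => y _.
  by rewrite mulgA ysymMr // mulrCA.
Qed.

Lemma ysym_conv x : \sum_y ysym y * ysym (y^-1 * x)%g = ysq * ysym x.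
Proof.
have := ysym_sandwich 1 x; rewrite invg1.
by under eq_bigr do rewrite mul1g; under [in RHS]eq_bigr do rewrite mul1g.
Qed.

(** Trace of [x] on the right ideal generated by the symmetrizer, the projection onto it being left
    multiplication by the symmetrizer divided by [ysq]. *)
Definition ychar (x : 'S_n) : F := ysq^-1 * \sum_g ysym (g * x^-1 * g^-1)%g.

(** The inverse of [r * c] is conjugate to [r^-1 * c^-1], again a product of a row and a column
    permutation, with the same sign. *)
Lemma sum_ysym_conjV x :
  \sum_g ysym (g * x^-1 * g^-1)%g = \sum_g ysym (g * x * g^-1)%g.
Proof.
have E (y : 'S_n) : \sum_g ysym (g * y * g^-1)%g =
    \sum_(r in RG) \sum_(c in CG) (-1) ^+ c * \sum_g (r * c == g * y * g^-1)%g%:R.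
  rewrite exchange_big; apply: eq_bigr => r _; rewrite exchange_big.
  by apply: eq_bigr => c _; rewrite mulr_sumr.
rewrite !E (reindex_inj invg_inj) /=; apply: eq_big => [r|r _].
  by rewrite row_group_key key_stabV.
rewrite (reindex_inj invg_inj) /=; apply: eq_big => [c|c _].
  by rewrite col_group_key key_stabV.
rewrite odd_permV; congr (_ * _); rewrite [RHS](reindex_inj (mulgI c^-1%g)) /=.
apply: eq_bigr => g _; congr (nat_of_bool _)%:R.
rewrite -[LHS](inj_eq invg_inj) -[RHS](inj_eq (mulgI c)) !invMg !invgK.
by rewrite !mulgA mulgV mul1g (inj_eq (mulIg c)).
Qed.

Let ysum x : F := \sum_g ysym (g * x^-1 * g^-1)%g.

Lemma ysum_conjg h x : ysum (h * x * h^-1)%g = ysum x.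
Proof.
rewrite /ysum [RHS](reindex_inj (mulIg h)) /=; apply: eq_bigr => g _.
by rewrite !invMg invgK !mulgA.
Qed.

(** Class invariance turns one factor [ysum x] into n! times [ysym x]; then [ysym_sandwich] and
    [ysym_conv] extract a factor [ysq] each. *)
Lemma sum_ychar_sq : ysq != 0 -> \sum_x ychar x * ychar x = n`!%:R.
Proof.
move=> k0; have -> : \sum_x ychar x * ychar x = ysq^-1 ^+ 2 * \sum_x ysum x * ysum x.
  rewrite mulr_sumr; apply: eq_bigr => x _; rewrite /ychar -/(ysum x); ring.
suff -> : \sum_x ysum x * ysum x = n`!%:R * ysq ^+ 2.
  by rewrite mulrCA -exprMn mulVf // expr1n mulr1.
transitivity (\sum_(h : 'S_n) \sum_x ysum x * ysym (h * x * h^-1)%g).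
  rewrite exchange_big; apply: eq_bigr => x _.
  by rewrite -mulr_sumr -sum_ysym_conjV.
have -> : n`!%:R = #|'S_n|%:R :> F by rewrite card_Sn.
rewrite mulr_natl -sumr_const; apply: eq_bigr => h _.
under eq_bigr do rewrite -(ysum_conjg h).
rewrite (sum_conjg h (fun x => ysum x * ysym x)) /ysum.
under eq_bigr do rewrite mulr_suml.
rewrite exchange_big /=.
transitivity (\sum_g (\sum_y ysym y * ysym (g^-1 * y^-1)%g) * ysym g).
  rewrite (reindex_inj invg_inj) /=; apply: eq_bigr => g _.
  rewrite -ysym_sandwich invgK; apply: eq_bigr => y _.
  by rewrite mulrC.
under eq_bigr do rewrite mulr_suml.
rewrite exchange_big expr2 [X in _ = X * _]/ysq mulr_suml; apply: eq_bigr => y _.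
rewrite -mulrA -[_ * ysq]mulrC -ysym_conv mulr_sumr; apply: eq_bigr => g _.
by rewrite -mulrA [X in _ * X]mulrC.
Qed.

Lemma sum_class_ychar (G : 'S_n -> F) :
  (forall h x, G (h * x * h^-1)%g = G x) ->
  \sum_x G x * ychar x =
  ysq^-1 * n`!%:R * \sum_(r in RG) \sum_(c in CG) (-1) ^+ c * G (r * c)%g.
Proof.
move=> GJ; rewrite -sum_ysym -mulrA.
transitivity (ysq^-1 * \sum_(h : 'S_n) \sum_x G x * ysym (h * x * h^-1)%g).
  rewrite exchange_big mulr_sumr; apply: eq_bigr => x _.
  by rewrite /ychar sum_ysym_conjV mulrCA mulr_sumr.
congr (_ * _); have -> : n`!%:R = #|'S_n|%:R :> F by rewrite card_Sn.
rewrite mulr_natl -sumr_const; apply: eq_bigr => h _.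
under eq_bigr do rewrite -(GJ h).
rewrite (sum_conjg h (fun x => G x * ysym x)).
by apply: eq_bigr => x _; rewrite mulrC.
Qed.

Lemma ysymV x :
  ysym x^-1%g = \sum_(d in CG) (-1) ^+ d * ((d^-1 * x)%g \in RG)%:R.
Proof.
rewrite /ysym exchange_big (reindex_inj invg_inj) /=.
apply: eq_big => [d|d _]; first by rewrite col_group_key key_stabV.
rewrite odd_permV -mulr_sumr; congr (_ * _); rewrite row_group_key.
have [dR|no] := boolP (_ \in _); last first.
  apply: big1 => r rR; case: eqP => // /(congr1 invg).
  rewrite invMg !invgK => E; case/negP: no.
  by rewrite -E mulKg key_stabV.
rewrite (bigD1 (d^-1 * x)^-1%g) ?key_stabV //= invMg invgK mulgK eqxx.
rewrite big1 ?addr0 // => r /andP[_ rx]; case: eqP => // /(canRL (mulgKV _)).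
by move=> E; rewrite E eqxx in rx.
Qed.

(** * Inner product of the character with [psi] *)

Section Pairing.
Variable N : nat.
Hypothesis la_N : (size la <= N)%N.
Implicit Types f : {ffun 'I_n -> 'I_N}.

Let row_w := row_word la_N.

Lemma wsum_conjg (W : {ffun 'I_N -> nat} -> F) (h x : 'S_n) :
  wsum (h * x * h^-1)%g W = wsum x W.
Proof.
have h_inj : injective (fun f : {ffun 'I_n -> 'I_N} => [ffun k => f (h k)]).
  move=> f g /ffunP E; apply/ffunP => k.
  by have := E (h^-1%g k); rewrite !ffunE permKV.
rewrite /wsum (reindex_inj h_inj) /=; apply: eq_big => [f|f _].
  apply/forallP/forallP => H k.
    by have := H (h^-1%g k); rewrite !ffunE !permM !permKV.
  by rewrite !ffunE !permM permKV.
by rewrite wcontent_comp.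
Qed.

(** Diagonal coefficient at the word [f] of the symmetrizer acting on words by permutation of the
    places. *)
Definition yweight f : F :=
  \sum_(r in RG) \sum_(c in CG) (-1) ^+ c * (fixed_word (r * c)%g f)%:R.

Lemma sum_wsum_yweight (W : {ffun 'I_N -> nat} -> F) :
  \sum_(r in RG) \sum_(c in CG) (-1) ^+ c * wsum (r * c)%g W =
  \sum_f W (wcontent f) * yweight f.
Proof.
rewrite /yweight; under [RHS]eq_bigr do rewrite mulr_sumr.
rewrite [RHS]exchange_big; apply: eq_bigr => r _.
under [RHS]eq_bigr do rewrite mulr_sumr.
rewrite [RHS]exchange_big; apply: eq_bigr => c _.
rewrite /wsum mulr_sumr big_mkcond /=; apply: eq_bigr => f _.
by case: ifP => _; rewrite ?mulr0 // mulr1 mulrC.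
Qed.

(* Composing [c] with a transposition of two equal letters in a column. *)
Lemma yweight_eq0 f : ~ col_inj f -> yweight f = 0.
Proof.
move=> f_ninj.
have [i [j [cij [fij ij]]]] : exists i j : 'I_n, col i = col j /\ f i = f j /\ i != j.
  apply: contrapT => no; apply: f_ninj => i j cij fij; apply/eqP.
  by apply: contrapT => /negP ij; apply: no; exists i, j.
apply: big1 => r _; pose t := tperm i j.
have tC : t \in CG by rewrite col_group_key; apply: tperm_key_stab.
apply: (@sign_cancel _ _ _ _ (fun w => w * t)%g) => //.
- by move=> w; rewrite -mulgA tperm2 mulg1.
- by move=> w; rewrite /= col_group_key key_stabMr -?col_group_key.
- by move=> w _; rewrite odd_permM odd_tperm ij addbT.
move=> c _; congr (nat_of_bool _)%:R; apply: eq_forallb => k.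
by rewrite mulgA permM /t; case: tpermP => // ->; rewrite fij.
Qed.

Lemma row_word_comp_inj : {in CG &, injective
  (fun c : 'S_n => [ffun k => row_w (c k)] : {ffun 'I_n -> 'I_N})}.
Proof.
rewrite col_group_key => c d /key_stabP cC /key_stabP dC /ffunP E.
apply/permP => k; apply: cell_inj; last by rewrite cC dC.
by have /(congr1 val) := E k; rewrite !ffunE.
Qed.

(** Only the words [row_w] composed with some [d] in [CG] contribute, and [r * c] fixes such a word
    exactly when [d^-1 * r * c * d] is in [RG]; this is the expansion of [ysq]. *)
Lemma sum_yweight_row_word :
  \sum_f (wcontent f == wcontent row_w)%:R * yweight f = ysq.
Proof.
transitivity (\sum_(c in CG) yweight [ffun k => row_w (c k)]).
  rewrite -(big_imset _ row_word_comp_inj) /= [RHS]big_mkcond /=.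
  apply: eq_bigr => f _; case: ifPn => [/imsetP[c cC ->]|no].
    by rewrite wcontent_comp eqxx mul1r.
  have [f_inj|/yweight_eq0 ->] := pselect (col_inj f); last by rewrite mulr0.
  case: eqP => [E|]; last by rewrite mul0r.
  have [c cC fc] := col_inj_row_word f_inj E.
  by case/imsetP: no; exists c => //; apply/ffunP => k; rewrite ffunE fc.
transitivity (\sum_(d in CG) \sum_(r in RG) \sum_(c in CG)
    (-1) ^+ d * (-1) ^+ c * ((d^-1 * r * c)%g \in RG)%:R : F).
  apply: eq_bigr => d dC; apply: eq_bigr => r _.
  have dC' : d \in key_stab (fun k : 'I_n => col k) by rewrite -col_group_key.
  rewrite (reindex_inj (mulIg d^-1%g)) /=; apply: eq_big => [c|c _].
    by rewrite col_group_key key_stabMr // key_stabV.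
  rewrite odd_permM odd_permV signr_addb [X in X * _]mulrC; congr (_ * (nat_of_bool _)%:R).
  rewrite row_group_key; apply/forallP/key_stabP => [H k|H k].
    have /eqP/(congr1 val) := H (d^-1%g k).
    by rewrite /= !ffunE /= !permM permKV permKV.
  apply/eqP/val_inj; rewrite /= !ffunE /= !permM permKV.
  by have := H (d k); rewrite !permM permK.
rewrite /ysq sum_ysym exchange_big; apply: eq_bigr => r rR.
rewrite exchange_big; apply: eq_bigr => c cC.
rewrite ysymV mulr_sumr; apply: eq_bigr => d _.
by rewrite mulgA mulrA [X in X * _]mulrC.
Qed.

(** The partial sums of the content of [f] are at most those of [la], so the partial sums of [w] are
    at most those of the identity; for a permutation this forces [w = 1], one value after the
    other. *)
Lemma fits_inj1 w (b : 'I_N -> nat) f :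
  (forall a, b a = nth 0%N la a + rev_ord a)%N ->
  col_inj f -> fits w b (wcontent f) -> w = 1%g.
Proof.
move=> bE f_inj /forallP fP; apply/permP => a; rewrite perm1.
have le_sum m : (\sum_(a < N | (a < m)%N) w a <= \sum_(a < N | (a < m)%N) a)%N.
  have dom := col_inj_dominated la_N m f_inj.
  have E : (\sum_(a < N | (a < m)%N) (wcontent f a + rev_ord (w a)) =
            \sum_(a < N | (a < m)%N) (wcontent (row_word la_N) a + rev_ord a))%N.
    by apply: eq_bigr => c _; rewrite wcontent_row_word (eqP (fP c)) bE.
  have S (s : 'I_N -> 'I_N) : (\sum_(a < N | (a < m)%N) (rev_ord (s a)) +
      \sum_(a < N | (a < m)%N) s a = \sum_(a < N | (a < m)%N) N.-1)%N.
    rewrite -big_split; apply: eq_bigr => c _ /=.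
    by have := ltn_ord (s c); lia.
  have := S w; have := S id; move: E; rewrite !big_split /=; move: dom.
  move: (\sum_(i < N | (i < m)%N) wcontent f i)%N (\sum_(i < N | (i < m)%N) wcontent (row_word la_N) i)%N => A1 A2.
  move: (\sum_(i < N | (i < m)%N) (N - i.+1))%N (\sum_(i < N | (i < m)%N) (N - (w i).+1))%N => A3 A4.
  by lia.
have [m] := ubnP (val a); elim: m a => // m IH a; rewrite ltnS => am.
have := le_sum a.+1; rewrite (bigD1 a) //= [leqRHS](bigD1 a) //= => le1.
have E (c : 'I_N) : (c < a)%N -> w c = c.
  by move=> ca; apply: IH; apply: leq_trans ca am.
have Eq : (\sum_(i < N | (i < a.+1)%N && (i != a)) w i =
           \sum_(i < N | (i < a.+1)%N && (i != a)) i)%N.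
  apply: eq_bigr => c /andP[ca na]; rewrite E //.
  by rewrite ltn_neqAle -ltnS ca andbT; apply: contra na => /eqP/val_inj ->.
have wa : (w a <= a)%N by move: le1; rewrite Eq leq_add2r.
apply: val_inj; apply/eqP; rewrite eqn_leq wa leqNgt; apply/negP => wlt.
have /perm_inj wwa := E _ wlt.
by rewrite wwa ltnn in wlt.
Qed.

Lemma sum_psi_ychar (b : 'I_N -> nat) : ysq != 0 ->
  (forall a, b a = nth 0%N la a + rev_ord a)%N ->
  \sum_x psi F b x * ychar x = n`!%:R.
Proof.
move=> k0 bE; rewrite /psi; under eq_bigr do rewrite mulr_suml.
rewrite exchange_big (bigD1 1%g) //= [X in _ + X]big1 ?addr0 => [|w w1].
  under eq_bigr do rewrite odd_perm1 mul1r.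
  rewrite sum_class_ychar; last by move=> h x; rewrite wsum_conjg.
  transitivity (ysq^-1 * n`!%:R * ysq); last by rewrite mulrAC mulVf // mul1r.
  congr (_ * _); rewrite sum_wsum_yweight -[RHS]sum_yweight_row_word.
  apply: eq_bigr => f _; congr ((nat_of_bool _)%:R * _).
  apply/forallP/eqP => [H|-> a]; last by rewrite perm1 wcontent_row_word bE.
  apply/ffunP => a; rewrite wcontent_row_word.
  by have := H a; rewrite perm1 bE eqn_add2r => /eqP.
under eq_bigr do rewrite -mulrA; rewrite -mulr_sumr.
rewrite sum_class_ychar; last by move=> h x; rewrite wsum_conjg.
rewrite sum_wsum_yweight big1 ?mulr0 // => f _.
have [f_inj|/yweight_eq0 ->] := pselect (col_inj f); last by rewrite mulr0.
case: (boolP (fits _ _ _)) => [/(fits_inj1 bE f_inj) w1'|_]; last by rewrite mul0r.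
by rewrite w1' eqxx in w1.
Qed.

Lemma psi_ychar (b : 'I_N -> nat) : ysq != 0 ->
  (forall a, b a = nth 0%N la a + rev_ord a)%N -> forall x : 'S_n, psi F b x = ychar x.
Proof.
move=> k0 bE.
have sum_b : (\sum_a b a = n + \sum_(a < N) rev_ord a)%N.
  under eq_bigr do rewrite bE; rewrite big_split /=; congr (_ + _)%N.
  rewrite -(sum_wcontent (row_word la_N)).
  by apply: eq_bigr => a _; rewrite wcontent_row_word.
have b_dec : decreasing b.
  move=> a c ac; rewrite !bE /=; have := nth_diagram_le (ltnW ac).
  by have := ltn_ord c; lia.
have norm_psi := psi_orthonormal F b_dec b_dec sum_b.
have {}norm_psi : \sum_(x : 'S_n) psi F b x * psi F b x = n`!%:R.
  rewrite norm_psi; case: (boolP [forall a, _]); rewrite ?muln1 //.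
  by case/forallPn => a; rewrite eqxx.
(* Realness makes the squares below nonnegative, so that their vanishing sum kills each of them. *)
have real_diff x : psi F b x - ychar x \is Num.real.
  rewrite rpredB //.
    apply: rpred_sum => w _; rewrite rpredMsign.
    by apply: rpred_sum => f _; rewrite realn.
  rewrite rpredM ?rpredV //; last by apply: rpred_sum => g _; rewrite ysym_real.
  by apply: rpred_sum => y _; rewrite rpredM ?ysym_real.
have sum0 : \sum_x (psi F b x - ychar x) ^+ 2 = 0.
  under eq_bigr do rewrite sqrrB.
  rewrite big_split sumrB /=; under eq_bigr do rewrite expr2.
  under [X in _ + X]eq_bigr do rewrite expr2.
  by rewrite norm_psi sum_ychar_sq // sumrMnl sum_psi_ychar // mulr2n; ring.
move=> x; apply/eqP; rewrite -subr_eq0 -sqrf_eq0; apply/eqP.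
apply: (psumr_eq0P _ sum0) => // y _.
by apply: real_exprn_even_ge0.
Qed.

End Pairing.

End YoungSymmetrizer.

(** * The characters of the Specht modules *)

Section SpechtCharacter.
Variables (R : realType) (n : nat) (la : seq nat).
Hypothesis la_diag : young_diagram n la.

Local Notation C := (R[i]).
Local Notation G := [set: 'S_n]%G.
Local Notation regG := (regular_repr C G).
Local Notation ys := (young_symmetrizer R n la).
Local Notation U := (specht_mx R n la).
Local Notation rho := (Defs.irr_repr R n la).
Local Notation ey := (@ysym n la C).
Local Notation kap := (ysq n la C).

Let dl (x : 'S_n) : 'rV[C]_#|G| := gring_row (regG x).

Let dlE x : dl x = delta_mx 0 (gring_index G x).
Proof. by rewrite /dl /gring_row rowK gring_indexK ?inE // mul1g. Qed.

Let gring_index_inj : injective (gring_index G).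
Proof. by apply: (can_inj (g := enum_val)) => x; rewrite gring_indexK ?inE. Qed.

Let dl_coef x y : dl x 0 (gring_index G y) = (x == y)%:R.
Proof. by rewrite dlE mxE eqxx (inj_eq gring_index_inj) eq_sym. Qed.

Let dlM x y : dl x *m regG y = dl (x * y)%g.
Proof. by rewrite /dl -gring_row_mul repr_mxM ?inE. Qed.

Let sum_gring (V : nmodType) (F : 'I_#|G| -> V) :
  \sum_i F i = \sum_(x : 'S_n) F (gring_index G x).
Proof.
rewrite (reindex (gring_index G)) //=.
exists enum_val => x _; first by rewrite gring_indexK ?inE.
by rewrite gring_valK.
Qed.

Let dl_eq m (A B : 'M[C]_(#|G|, m)) : (forall x, dl x *m A = dl x *m B) -> A = B.
Proof.
move=> AB; apply/row_matrixP => i; have := AB (enum_val i).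
by rewrite !dlE gring_valK -!rowE.
Qed.

Let ysE : ys = \sum_x ey x *: dl x.
Proof.
rewrite /young_symmetrizer /ysym.
under [RHS]eq_bigr do rewrite scaler_suml.
rewrite [RHS]exchange_big; apply: eq_bigr => r _.
under [RHS]eq_bigr do rewrite scaler_suml.
rewrite [RHS]exchange_big; apply: eq_bigr => c _.
rewrite (bigD1 (r * c)%g) //= eqxx mulr1 big1 ?addr0 // => x.
by rewrite eq_sym => /negPf ->; rewrite mulr0 scale0r.
Qed.

(** Left multiplication by the symmetrizer. It commutes with the right regular action, has the
    Specht module as image, and is [kap] times a projection. *)
Let left_mx : 'M[C]_#|G| := \matrix_i (ys *m regG (enum_val i)).

Let dl_left x : dl x *m left_mx = ys *m regG x.
Proof. by rewrite dlE -rowE rowK gring_indexK ?inE. Qed.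

Let left_comm x : left_mx *m regG x = regG x *m left_mx.
Proof.
apply: dl_eq => g; rewrite !mulmxA dl_left dlM dl_left.
by rewrite -mulmxA -repr_mxM ?inE.
Qed.

Let ys_left : ys *m left_mx = kap *: ys.
Proof.
rewrite {1}ysE mulmx_suml.
under eq_bigr do rewrite -scalemxAl dl_left {1}ysE mulmx_suml scaler_sumr.
rewrite exchange_big /= ysE scaler_sumr.
transitivity (\sum_y \sum_x (ey y * ey (y^-1 * x)%g) *: dl x).
  apply: eq_bigr => y _; rewrite [RHS](reindex_inj (mulgI y)) /=.
  apply: eq_bigr => x _.
  by rewrite mulKg -scalemxAl dlM scalerA mulrC.
rewrite exchange_big; apply: eq_bigr => x _.
by rewrite -scaler_suml ysym_conv // scalerA.
Qed.

Let left_sq : left_mx *m left_mx = kap *: left_mx.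
Proof.
apply: dl_eq => g; rewrite mulmxA dl_left -mulmxA -left_comm mulmxA ys_left.
by rewrite -scalemxAl -scalemxAr dl_left.
Qed.

Let specht_left : (U :=: left_mx)%MS.
Proof.
apply/eqmxP/andP; split.
  apply: cyclic_mx_sub.
    by apply/mxmoduleP => x _; rewrite left_comm submxMl.
  have -> : ys = dl 1%g *m left_mx by rewrite dl_left repr_mx1 mulmx1.
  exact: submxMl.
apply/row_subP => i; rewrite rowK; apply/cyclic_mxP.
by exists (regG (enum_val i)); rewrite ?envelop_mx_id ?inE.
Qed.

Let trace_left x : \tr (left_mx *m regG x) = \sum_g ey (g * x^-1 * g^-1)%g.
Proof.
rewrite /mxtrace sum_gring; apply: eq_bigr => g _.
have -> : (left_mx *m regG x) (gring_index G g) (gring_index G g) =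
    (dl g *m (left_mx *m regG x)) 0 (gring_index G g).
  by rewrite dlE -rowE [RHS]mxE.
rewrite mulmxA dl_left -mulmxA -repr_mxM ?inE // ysE mulmx_suml summxE.
rewrite (bigD1 (g * x^-1 * g^-1)%g) //= big1 => [|y yx].
  by rewrite -scalemxAl dlM mxE dl_coef !mulgA !mulgKV eqxx mulr1 addr0.
rewrite -scalemxAl dlM mxE dl_coef; case: eqP => [E|]; last by rewrite mulr0.
by case/eqP: yx; rewrite -[LHS](mulgK (g * x)%g) E invMg mulgA.
Qed.

(** If [kap] were 0, [left_mx] would have square 0, hence trace 0; but its trace is n! times
    [ysym 1%g]. *)
Let ysq_neq0 : kap != 0.
Proof.
apply/eqP => k0; have /eqP := trace_left 1%g.
rewrite repr_mx1 mulmx1 -(mulmx_base left_mx) mxtrace_mulC.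
have -> : row_base left_mx *m col_base left_mx = 0.
  have := left_sq; rewrite k0 scale0r -{1 2}(mulmx_base left_mx).
  move/eqP; rewrite mulmxA mulmx_free_eq0 ?row_base_free // => /eqP E.
  have /row_fullP[B BC] := col_base_full left_mx.
  by rewrite -[LHS]mul1mx -BC -mulmxA [X in B *m X]mulmxA E mulmx0.
rewrite linear0 eq_sym.
under eq_bigr do rewrite invg1 mulg1 mulgV ysym1 //.
rewrite sumr_const -[_ *+ _]/(_%:R) pnatr_eq0 => /eqP/card0_eq/(_ 1%g).
by rewrite inE.
Qed.

(** [left_mx] divided by [kap] projects onto [U], so the trace on [U] is the trace of its product
    with [regG x] on the whole group algebra. *)
Lemma chi_ychar x : chi R n la x = ychar la C x.
Proof.
rewrite ffunE /ychar -trace_left.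
have baseL : row_base U *m left_mx = kap *: row_base U.
  have : (row_base U <= left_mx)%MS by rewrite eq_row_base specht_left.
  by case/submxP => D ->; rewrite -mulmxA left_sq scalemxAr.
have -> : \tr (rho x) = \tr (in_submod U 1%:M *m (row_base U *m regG x)).
  by rewrite [RHS]mxtrace_mulC -in_submodE -[row_base U]mul1mx.
have -> : row_base U = kap^-1 *: (row_base U *m left_mx).
  by rewrite baseL scalerA mulVf ?scale1r // ysq_neq0.
rewrite -scalemxAl -scalemxAr mxtraceZ; congr (_ * _).
have : left_mx *m in_submod U 1%:M *m row_base U = left_mx.
  by rewrite -in_submodE; apply: in_submodK; rewrite specht_left submx_refl.
move: (left_comm x).
move: (in_submod U 1%:M) (row_base U) (regG x) => Q B X LX QB.
by rewrite -[B *m _ *m X]mulmxA LX !mulmxA mxtrace_mulC !mulmxA QB LX.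
Qed.

Lemma chi_psi N (b : 'I_N -> nat) x : (size la <= N)%N ->
  (forall a, b a = nth 0%N la a + rev_ord a)%N -> chi R n la x = psi C b x.
Proof. by move=> la_N bE; rewrite chi_ychar (psi_ychar la_diag la_N ysq_neq0 bE). Qed.

(** Gram matrix of the standard bilinear form, invariant because [regG x] is orthogonal. It
    identifies the Specht module with its dual. *)
Let form : 'M[C]_(\rank U) := row_base U *m (row_base U)^T.

Let row_base_rho x : row_base U *m regG x = rho x *m row_base U.
Proof.
have := @val_submodJ _ _ _ _ _ _ (cyclic_mx_module regG ys) _ 1%:M x (finset.in_setT _).
by rewrite mul1mx /val_submod /= mul1mx => ->.
Qed.

Let reg_orth x : regG x *m (regG x)^T = 1%:M.
Proof.
apply/matrixP => i k; rewrite !mxE.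
rewrite (bigD1 (gring_index G (enum_val i * x)%g)) //= !mxE !eqxx mul1r.
rewrite big1 ?addr0 => [|l li]; last by rewrite !mxE /= (negPf li) mul0r.
by rewrite /= (inj_eq gring_index_inj) (inj_eq (mulIg x)) (inj_eq enum_val_inj).
Qed.

Let form_rho x : form *m (rho x)^T = rho x^-1%g *m form.
Proof.
have E : rho x *m form *m (rho x)^T = form.
  rewrite /form mulmxA -row_base_rho -!mulmxA -trmx_mul -row_base_rho.
  by rewrite trmx_mul !mulmxA -[_ *m (regG x)^T]mulmxA reg_orth mulmx1.
have := repr_mxM rho (finset.in_setT x^-1%g) (finset.in_setT x).
rewrite mulVg repr_mx1 => /esym; move: E.
move: (rho x) (rho x^-1%g) form => A B D E AB.
by rewrite -{2}E !mulmxA AB mul1mx.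
Qed.

Let left_real : map_mx Num.conj left_mx = left_mx.
Proof.
apply/matrixP => i k; rewrite mxE conj_Creal // mxE ysE mulmx_suml summxE.
apply: rpred_sum => y _; rewrite -scalemxAl dlM dlE !mxE.
by rewrite rpredM ?ysym_real ?realn.
Qed.

(** A complex bilinear form may have isotropic vectors; here [U] is stable under conjugation,
    [left_mx] being real, and pairing [a] with its conjugate gives a sum of squared moduli. *)
Let form_unit : form \in unitmx.
Proof.
rewrite -row_free_unit -kermx_eq0; apply/rowV0P => w /sub_kermxP w0.
pose a := w *m row_base U.
have aL : (a <= left_mx)%MS.
  by apply: submx_trans (submxMl _ _) _; rewrite eq_row_base specht_left.
have [v va] : exists v, map_mx Num.conj a = v *m row_base U.
  apply/submxP; rewrite eq_row_base specht_left.
  by case/submxP: aL => v ->; rewrite map_mxM left_real submxMl.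
have aa : a *m (map_mx Num.conj a)^T = 0.
  by rewrite va trmx_mul mulmxA -[_ *m (row_base U)^T]mulmxA w0 mul0mx.
have a0 : a = 0.
  apply/rowP => i; have /matrixP/(_ 0 0) := aa; rewrite !mxE => /psumr_eq0P.
  move=> /(_ _ i isT); rewrite !mxE => H; apply/eqP.
  rewrite -mul_conjC_eq0; apply/eqP; apply: H => k _; rewrite !mxE.
  exact: mul_conjC_ge0.
by apply/eqP; rewrite -(mulmx_free_eq0 _ (row_base_free U)) -/a a0.
Qed.

(** Matrix coefficients. The factor [form] converts the action of [g.2], not transposed in
    [tensor_act], into the [g.2^-1] of [Reg]. *)
Definition specht_emb (A : 'M[C]_(\rank U)) : Hn R n :=
  [ffun x => \tr (A^T *m rho x *m form)].

Fact specht_emb_linear : linear specht_emb.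
Proof.
move=> c A B; apply/ffunP => x; rewrite !ffunE.
by rewrite linearP /= mulmxDl mulmxDl -!scalemxAl mxtraceD mxtraceZ.
Qed.

HB.instance Definition _ :=
  GRing.isLinear.Build C _ _ _ specht_emb specht_emb_linear.

Lemma chi_H_la (c : C) : H_la la (c *: chi R n la).
Proof.
(* The transposed inverse cancels [form], which leaves the plain trace. *)
exists specht_emb, (c *: (invmx form)^T); split.
  move=> g A; apply/ffunP => x; rewrite !ffunE /tensor_act.
  have -> := repr_mxM rho (finset.in_setT (g.1 * x)%g) (finset.in_setT g.2^-1%g).
  have -> := repr_mxM rho (finset.in_setT g.1) (finset.in_setT x).
  have := form_rho g.2.
  move: (rho g.1) (rho x) (rho g.2) (rho g.2^-1%g) form => B X D D' S SD.
  rewrite !trmx_mul trmxK -!mulmxA -SD [LHS]mxtrace_mulC !mulmxA.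
  by [].
apply/ffunP => x; rewrite !ffunE linearZ /= trmxK -!scalemxAl mxtraceZ.
congr (_ * _); rewrite [RHS]mxtrace_mulC mulmxA mulmxV //.
by rewrite mul1mx.
Qed.

End SpechtCharacter.

(** * Branching *)

Lemma young_diagramP n la : reflect
  [/\ forall i, (nth 0%N la i.+1 <= nth 0%N la i)%N,
      forall i, (i < size la)%N -> (0 < nth 0%N la i)%N & sumn la = n]
  (young_diagram n la).
Proof.
apply: (iffP and3P) => [[la_s la_p /eqP la_n]|[la_s la_p la_n]]; split=> //.
- by move=> i; apply: (@nth_diagram_le n) => //; apply/and3P; rewrite la_n.
- by move=> i /(all_nthP 0%N la_p).
- by apply/(sortedP 0%N) => i _; apply: la_s.
- by apply/(all_nthP 0%N) => i; apply: la_p.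
- by apply/eqP.
Qed.

Lemma diagram_sumn n la : young_diagram n la -> sumn la = n.
Proof. by case/young_diagramP. Qed.

Lemma size_le_sumn s : (forall i, (i < size s)%N -> (0 < nth 0%N s i)%N) ->
  (size s <= sumn s)%N.
Proof.
elim: s => //= x s IH H; have := H 0%N isT => /= x0.
have := IH (fun i => H i.+1); lia.
Qed.

Lemma diagram_size n la : young_diagram n la -> (size la <= n)%N.
Proof. by case/young_diagramP => _ la_p <-; apply: size_le_sumn. Qed.

Lemma eq_pos_nth s s' : (forall i, (i < size s)%N -> (0 < nth 0%N s i)%N) ->
  (forall i, (i < size s')%N -> (0 < nth 0%N s' i)%N) ->
  (forall i, nth 0%N s i = nth 0%N s' i)%N -> s = s'.
Proof.
move=> sp sp' E; apply: (@eq_from_nth _ 0%N) => //.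
case: (ltngtP (size s) (size s')) => // lt_s.
  by have := sp' _ lt_s; rewrite -E nth_default.
by have := sp _ lt_s; rewrite E nth_default.
Qed.

Lemma diagram_inj m n la mu : young_diagram m la -> young_diagram n mu ->
  (forall i, nth 0%N la i = nth 0%N mu i)%N -> la = mu.
Proof. by case/young_diagramP => _ lp _ /young_diagramP[_ mp _]; apply: eq_pos_nth. Qed.

Lemma diagram_exists (l : nat -> nat) N : (forall i, l i.+1 <= l i)%N ->
  (forall i, (N <= i)%N -> l i = 0%N) ->
  exists2 la, young_diagram (\sum_(i < N) l i) la & forall i, nth 0%N la i = l i.
Proof.
elim: N l => [|N IH] l l_dec l0.
  exists [::] => [|i]; last by rewrite nth_nil l0.
  by rewrite big_ord0.
have [l00|l0_gt] := posnP (l 0).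
  have all0 i : l i = 0%N.
    by elim: i => // i IHi; apply/eqP; rewrite -leqn0 -IHi.
  exists [::] => [|i]; last by rewrite nth_nil all0.
  by rewrite big1.
have [la la_d laE] := IH (l \o S) (fun i => l_dec i.+1) (fun i => l0 i.+1).
have [la_s la_p la_n] := young_diagramP _ _ la_d.
exists (l 0%N :: la) => [|[|i]] //=.
apply/young_diagramP; split=> [[|i]|[|i] //|] /=.
- by rewrite laE; apply: l_dec.
- exact: la_s.
- exact: la_p.
- by rewrite la_n big_ord_recl.
Qed.

Lemma sumn_incr_nth s b : sumn (incr_nth s b) = (sumn s).+1.
Proof. by elim: s b => [|x s IH] [|b] //=; rewrite ?IH ?addnS //; elim: b => //= b ->. Qed.

Lemma sumn_nth s N : (size s <= N)%N -> sumn s = (\sum_(i < N) nth 0%N s i)%N.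
Proof.
elim: N s => [|N IH] [|x s] //= sN; rewrite ?big_ord0 //.
  by rewrite big1 // => i _; rewrite nth_nil.
by rewrite big_ord_recl /= (IH s).
Qed.

Lemma remove_box n mu b : young_diagram n.+1 mu -> (nth 0%N mu b.+1 < nth 0%N mu b)%N ->
  exists2 la, young_diagram n la & incr_nth la b = mu.
Proof.
move=> mu_d mu_b; have [mu_s mu_p mu_n] := young_diagramP _ _ mu_d.
have b_mu : (b < size mu)%N.
  by rewrite ltnNge; apply/negP => ?; rewrite [X in (_ < X)%N]nth_default in mu_b.
pose l i := (nth 0%N mu i - (b == i))%N.
have [i|i mi|la la_d laE] := @diagram_exists l (size mu).
- have := mu_s i; rewrite /l; have [<-|_] := eqVneq b i; last by case: eqP; lia.
  by rewrite (negPf (_ : b != b.+1)); lia.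
- by rewrite /l nth_default.
have incrE i : nth 0%N (incr_nth la b) i = nth 0%N mu i.
  rewrite nth_incr_nth laE /l; case: eqP => [<-|_]; last by rewrite subn0.
  by rewrite add1n subn1 prednK // (leq_ltn_trans _ mu_b).
have incr_mu : incr_nth la b = mu.
  apply: eq_pos_nth => // i; rewrite incrE size_incr_nth.
  have [_ la_p _] := young_diagramP _ _ la_d; case: ifP => [_ /la_p|_].
    by rewrite laE => /leq_trans; apply; apply: leq_subr.
  rewrite ltnS => ib; apply: leq_trans (nth_diagram_le mu_d ib).
  by rewrite (leq_ltn_trans _ mu_b).
exists la => //; have := sumn_incr_nth la b; rewrite incr_mu mu_n => -[nE].
by rewrite nE (diagram_sumn la_d).
Qed.

Fixpoint bounded_seqs k m : seq (seq nat) :=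
  if k is k'.+1 then [::] :: [seq x :: s | x <- iota 0 m.+1, s <- bounded_seqs k' m]
  else [:: [::]].

Lemma bounded_seqsS k m : bounded_seqs k.+1 m =
  [::] :: [seq x :: s | x <- iota 0 m.+1, s <- bounded_seqs k m].
Proof. by []. Qed.

Lemma mem_bounded_seqs k m s : (size s <= k)%N -> (sumn s <= m)%N ->
  s \in bounded_seqs k m.
Proof.
elim: k s => [|k IH] [|x s] // sk xm; rewrite bounded_seqsS in_cons.
apply/orP; right; apply/allpairsP; exists (x, s); split=> //.
  by rewrite mem_iota /= add0n ltnS (leq_trans (leq_addr _ _) xm).
by apply: IH => //; rewrite (leq_trans (leq_addl _ _) xm).
Qed.

Definition diagrams n : seq (seq nat) :=
  undup [seq la <- bounded_seqs n n | young_diagram n la].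

Lemma mem_diagrams n la : (la \in diagrams n) = young_diagram n la.
Proof.
rewrite mem_undup mem_filter andbC; case: (boolP (young_diagram n la)) => la_d.
  by rewrite andbT mem_bounded_seqs // ?(diagram_size la_d) // (diagram_sumn la_d).
by rewrite andbF.
Qed.

Lemma sum_diagrams_eq (V : pzRingType) n la (G : seq nat -> V) :
  \sum_(mu <- diagrams n) (la == mu)%:R * G mu =
  if young_diagram n la then G la else 0.
Proof.
rewrite -mem_diagrams; case: ifP => la_d.
  rewrite (bigD1_seq la) ?undup_uniq //= eqxx mul1r big1 ?addr0 // => mu.
  by rewrite eq_sym => /negPf ->; rewrite mul0r.
rewrite big_seq big1 // => mu mu_d; case: eqP => [E|]; last by rewrite mul0r.
by rewrite E mu_d in la_d.
Qed.

Section Branching.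
Variable R : realType.
Local Notation C := R[i].

(** If a box can be removed from row [c], the lowered exponents are those of the smaller diagram;
    otherwise either [b c] is 0 or two lowered exponents coincide and [psi] vanishes. *)
Lemma psi_decr n mu (b : 'I_n.+1 -> nat) (c : 'I_n.+1) (y : 'S_n) :
  young_diagram n.+1 mu -> (forall a, b a = nth 0%N mu a + rev_ord a)%N ->
  (if (0 < b c)%N then psi C (decr b c) y else 0) =
  \sum_(la <- diagrams n) (incr_nth la c == mu)%:R * chi R n la y.
Proof.
move=> mu_d bE; have mu_s := diagram_size mu_d.
have [mu_c|mu_c] := ltnP (nth 0%N mu c.+1) (nth 0%N mu c).
  have bc : (0 < b c)%N by rewrite bE addn_gt0 (leq_ltn_trans _ mu_c).
  rewrite bc; have [la la_d la_mu] := remove_box mu_d mu_c.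
  transitivity (\sum_(la' <- diagrams n) (la == la')%:R * chi R n la' y).
    rewrite sum_diagrams_eq la_d (@chi_psi _ _ _ la_d _ (decr b c)) //.
      exact: leq_trans (diagram_size la_d) _.
    move=> a; rewrite /decr bE -la_mu nth_incr_nth addnAC -[in RHS]addnC.
    by rewrite -addnA addKn addnC.
  rewrite !big_seq; apply: eq_bigr => nu; rewrite mem_diagrams => nu_d.
  congr ((nat_of_bool _)%:R * _); apply/eqP/eqP => [<- //|E].
  apply: (diagram_inj la_d nu_d) => i.
  have := nth_incr_nth nu c i; have := nth_incr_nth la c i.
  by rewrite la_mu E; lia.
rewrite [RHS]big_seq [RHS]big1 => [|nu]; last first.
  rewrite mem_diagrams => nu_d; case: eqP => [E|]; last by rewrite mul0r.
  have [nu_s _ _] := young_diagramP _ _ nu_d.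
  move: mu_c; rewrite -E !nth_incr_nth eqxx (negPf (_ : c != c.+1 :> nat)).
    by have := nu_s c; lia.
  by apply/eqP; lia.
case: ifP => // bc; have mu_eq : nth 0%N mu c.+1 = nth 0%N mu c.
  by apply/eqP; rewrite eqn_leq mu_c andbT (nth_diagram_le mu_d (leqnSn c)).
(* In the last row, [mu] has length 0 like the row after it and the staircase is 0 too, which
   contradicts [bc]. *)
have [cN|cN] := ltnP c.+1 n.+1; last first.
  move: bc; rewrite bE /= -mu_eq nth_default ?(leq_trans mu_s) //.
  by have := ltn_ord c; lia.
apply: (@psi_eq0 _ _ _ c (Ordinal cN)).
  by rewrite -val_eqE /=; apply/eqP; lia.
rewrite /decr !bE /= eqxx -val_eqE /= mu_eq.
by rewrite (negPf (_ : c != c.+1 :> nat)) ; lia.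
Qed.

Lemma chi_plift n mu (y : 'S_n) : young_diagram n.+1 mu ->
  chi R n.+1 mu (plift y) =
  \sum_(la <- diagrams n) (\sum_(c < n.+1) (incr_nth la c == mu)%:R) * chi R n la y.
Proof.
move=> mu_d; pose b (a : 'I_n.+1) := (nth 0%N mu a + rev_ord a)%N.
rewrite (@chi_psi _ _ _ mu_d _ b) ?(diagram_size mu_d) // psi_plift big_mkcond /=.
under eq_bigr do rewrite (psi_decr _ y mu_d) //.
by rewrite exchange_big; apply: eq_bigr => la _; rewrite mulr_suml.
Qed.

(** The terms [k != ord_max] form the action of the Jucys-Murphy element, with eigenvalue the
    content [nth 0 la c - c] of the added box; [k = ord_max] gives the 1. *)
Lemma sum_chi_plift n mu (y : 'S_n) : young_diagram n.+1 mu ->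
  \sum_k chi R n.+1 mu (plift y * tperm k ord_max)%g =
  \sum_(la <- diagrams n) (\sum_(c < n.+1) (incr_nth la c == mu)%:R *
      (1 + (nth 0%N la c)%:R - c%:R)) * chi R n la y.
Proof.
move=> mu_d; pose b (a : 'I_n.+1) := (nth 0%N mu a + rev_ord a)%N.
under eq_bigr do rewrite (@chi_psi _ _ _ mu_d _ b) ?(diagram_size mu_d) //.
rewrite sum_psi_plift big_mkcond /=.
transitivity (\sum_(c < n.+1) ((b c)%:R - n%:R) *
   \sum_(la <- diagrams n) (incr_nth la c == mu)%:R * chi R n la y).
  apply: eq_bigr => c _; rewrite -(@psi_decr _ mu b c y mu_d) //.
  by case: ifP; rewrite ?mulr0.
under [LHS]eq_bigr => c _ do rewrite mulr_sumr.
rewrite exchange_big; apply: eq_bigr => la _; rewrite mulr_suml.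
apply: eq_bigr => c _; rewrite mulrA; congr (_ * _); rewrite mulrC.
case: eqP => [E|]; last by rewrite !mul0r.
rewrite !mul1r /b -E nth_incr_nth eqxx /= subSS natrD natrB -1?ltnS // natrD.
ring.
Qed.

(** A sum over the fibre of [proj]; the correction by [z^* - 1] changes the weight of the
    fixed-point term from 1 to [z^*]. *)
Definition Lz_adj (z : C) n (F : Hn R n.+1) : Hn R n :=
  [ffun y => sqrtC (n.+1%:R / (`|z| ^+ 2 + n%:R)) / n.+1%:R *
    (\sum_k F (plift y * tperm k ord_max)%g + (z^* - 1) * F (plift y))].

Lemma Hn_dot_Lz (z : C) n (F : Hn R n.+1) (g : Hn R n) :
  Hn_dot F (Lz z g) = Hn_dot (Lz_adj z F) g.
Proof.
rewrite /Hn_dot sum_permS factS natrM invfM [X in X * _]mulrC -mulrA; congr (_ * _).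
rewrite mulr_sumr; apply: eq_bigr => y _; rewrite ffunE.
set s := sqrtC _; have sR : s^* = s.
  by apply: geC0_conj; rewrite sqrtC_ge0 divr_ge0 // addr_ge0 // exprn_ge0.
transitivity (n.+1%:R^-1 * ((\sum_k F (plift y * tperm k ord_max)%g *
    (if k == ord_max then z^* else 1)) * (s * (g y)^*))).
  congr (_ * _); rewrite mulr_suml; apply: eq_bigr => k _.
  rewrite ffunE proj_mul_plift mul_plift_tperm_max !rmorphM /= sR.
  by case: ifP; rewrite ?rmorph1 !mulrA.
suff -> : \sum_k F (plift y * tperm k ord_max)%g *
    (if k == ord_max then z^* else 1) =
    \sum_k F (plift y * tperm k ord_max)%g + (z^* - 1) * F (plift y) by ring.
rewrite (bigD1 ord_max) //= [in RHS](bigD1 ord_max) //= eqxx tperm1 mulg1.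
have -> : \sum_(i < n.+1 | i != ord_max) F (plift y * tperm i ord_max)%g *
    (if i == ord_max then z^* else 1) =
    \sum_(i < n.+1 | i != ord_max) F (plift y * tperm i ord_max)%g.
  by apply: eq_bigr => k /negPf ->; rewrite mulr1.
ring.
Qed.

Definition chi_comb (f : nat -> seq nat -> C) n : Hn R n :=
  \sum_(la <- diagrams n) f n la *: chi R n la.

(** The row [c] receives the new box, of content [nth 0 la c - c]; a diagram with n boxes accepts
    none beyond row n, counted from 0. *)
Definition coherent (z : C) (f : nat -> seq nat -> C) := forall n la,
  (0 < n)%N -> young_diagram n la ->
  f n la = sqrtC (n.+1%:R / (`|z| ^+ 2 + n%:R)) / n.+1%:R *
    \sum_(c < n.+1) (if young_diagram n.+1 (incr_nth la c)
       then (z^* + (nth 0%N la c)%:R - c%:R) * f n.+1 (incr_nth la c) else 0).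

Lemma Lz_adj_chi_comb z f n : coherent z f -> (0 < n)%N ->
  Lz_adj z (chi_comb f n.+1) = chi_comb f n.
Proof.
move=> f_coh n0; apply/ffunP => y; rewrite ffunE.
have combE m (x : 'S_m) : chi_comb f m x = \sum_(la <- diagrams m) f m la * chi R m la x.
  by rewrite /chi_comb sum_ffunE; apply: eq_bigr => la _; rewrite ffunE.
rewrite !combE; under [X in _ * (X + _)]eq_bigr do rewrite combE.
rewrite exchange_big mulr_sumr -big_split /=.
set s := _ / n.+1%:R.
transitivity (s * \sum_(mu <- diagrams n.+1) \sum_(la <- diagrams n)
   (\sum_(c < n.+1) (incr_nth la c == mu)%:R * ((z^* + (nth 0%N la c)%:R - c%:R) *
     f n.+1 mu)) * chi R n la y).
  congr (_ * _); rewrite !big_seq; apply: eq_bigr => mu.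
  rewrite mem_diagrams => mu_d; rewrite -mulr_sumr (sum_chi_plift _ mu_d).
  rewrite (chi_plift _ mu_d) mulrCA -mulrDr.
  rewrite [in X in _ * (_ + X)]mulr_sumr -big_split /= mulr_sumr.
  apply: eq_bigr => la _; rewrite mulrA -mulrDl mulrA; congr (_ * _).
  rewrite mulr_sumr -big_split /= mulr_sumr.
  by apply: eq_bigr => c _; ring.
rewrite exchange_big mulr_sumr !big_seq; apply: eq_bigr => la.
rewrite mem_diagrams => la_d /=; rewrite -mulr_suml mulrA; congr (_ * _).
rewrite (f_coh n la n0 la_d) -/s; congr (_ * _).
rewrite exchange_big; apply: eq_bigr => c _.
rewrite (sum_diagrams_eq _ _ (fun mu => (z^* + (nth 0%N la c)%:R - c%:R) * f n.+1 mu)).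
by [].
Qed.

Lemma chi_ortho n la mu : young_diagram n la -> young_diagram n mu ->
  Hn_dot (chi R n la) (chi R n mu) = (la == mu)%:R.
Proof.
move=> la_d mu_d.
pose bl nu (a : 'I_n) := (nth 0%N nu a + rev_ord a)%N.
have bl_dec nu : young_diagram n nu -> decreasing (bl nu).
  move=> nu_d a c ac; rewrite /bl /=; have := nth_diagram_le nu_d (ltnW ac).
  by have := ltn_ord c; lia.
rewrite /Hn_dot.
transitivity ((n`!%:R)^-1 * \sum_(x : 'S_n) psi C (bl la) x * psi C (bl mu) x).
  congr (_ * _); apply: eq_bigr => x _.
  congr (_ * _); first by apply: (@chi_psi _ _ _ la_d _ (bl la)); rewrite ?diagram_size.
  rewrite -[RHS](rmorph_psi Num.conj); congr (_^*).
  by apply: (@chi_psi _ _ _ mu_d _ (bl mu)); rewrite ?diagram_size.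
rewrite psi_orthonormal; first last.
- by rewrite big_split /= -(sumn_nth (diagram_size la_d)) (diagram_sumn la_d).
- exact: bl_dec.
- exact: bl_dec.
rewrite natrM mulrA mulVf ?mul1r; last by rewrite pnatr_eq0 -lt0n fact_gt0.
congr (nat_of_bool _)%:R; apply/forallP/eqP => [H|-> //].
apply: (diagram_inj la_d mu_d) => i.
have [i_n|n_i] := ltnP i n; last first.
  rewrite !nth_default //; first exact: leq_trans (diagram_size mu_d) n_i.
  exact: leq_trans (diagram_size la_d) n_i.
by have := H (Ordinal i_n); rewrite /bl /= eqn_add2r => /eqP.
Qed.

Lemma Hn_dotDZl n c (F F' g : Hn R n) :
  Hn_dot (c *: F + F') g = c * Hn_dot F g + Hn_dot F' g.
Proof.
rewrite /Hn_dot mulrCA -mulrDr; congr (_ * _); rewrite mulr_sumr -big_split /=.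
by apply: eq_bigr => x _; rewrite !ffunE mulrDl mulrA.
Qed.

Lemma Hn_dot_chi_comb f n mu : young_diagram n mu ->
  Hn_dot (chi_comb f n) (chi R n mu) = f n mu.
Proof.
move=> mu_d.
transitivity (\sum_(la <- diagrams n) (mu == la)%:R * f n la); last first.
  by rewrite sum_diagrams_eq mu_d.
rewrite /chi_comb !big_seq.
elim/big_rec2: _ => [|la x F la_d <-].
  by rewrite /Hn_dot big1 ?mulr0 // => x _; rewrite ffunE mul0r.
rewrite mem_diagrams in la_d.
by rewrite Hn_dotDZl chi_ortho // mulrC eq_sym.
Qed.

Lemma Hn_dot_chi_comb2 f n :
  Hn_dot (chi_comb f n) (chi_comb f n) = \sum_(la <- diagrams n) `|f n la| ^+ 2.
Proof.
transitivity (\sum_(la <- diagrams n) (f n la)^* * Hn_dot (chi_comb f n) (chi R n la)).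
  rewrite {2}/chi_comb; elim/big_rec2: _ => [|la x F _ <-].
    by rewrite /Hn_dot big1 ?mulr0 // => x _; rewrite ffunE rmorph0 mulr0.
  rewrite /Hn_dot mulrCA -mulrDr; congr (_ * _); rewrite mulr_sumr -big_split /=.
  by apply: eq_bigr => y _; rewrite !ffunE rmorphD rmorphM mulrDr mulrCA.
rewrite !big_seq; apply: eq_bigr => la; rewrite mem_diagrams => la_d.
by rewrite Hn_dot_chi_comb // normCK mulrC.
Qed.

End Branching.

(** * Coherence of the functions f_pq *)

Section VandermondeIdentity.
Variable F : comNzRingType.
Implicit Types x : nat -> F.

Definition vdprod m x : F := \prod_(0 <= i < m) \prod_(i.+1 <= l < m) (x i - x l).

Definition shift1 x c : nat -> F := fun a => x a + (a == c)%:R.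

Section Determinant.
Variables (m : nat) (x : nat -> F).

Let vdet y := \det (Vandermonde m (\row_(j < m) y (j : nat)) : 'M[F]_m).

Let vdet_sum y : vdet y = \sum_(s : 'S_m) (-1) ^+ s * \prod_(i < m) y (s i) ^+ i.
Proof.
apply: eq_bigr => s _; congr (_ * _).
by apply: eq_bigr => i _; rewrite !mxE.
Qed.

(** The Vandermonde determinant whose row of k-th powers is replaced by the values of [phi]. *)
Let replaced (k : 'I_m) (phi : F -> F) : F :=
  \sum_(s : 'S_m) (-1) ^+ s *
    (phi (x (s k)) * \prod_(i < m | i != k) x (s i) ^+ i).

Let replaced_pow (k : 'I_m) : replaced k (fun u => u ^+ k) = vdet x.
Proof.
rewrite vdet_sum; apply: eq_bigr => s _; congr (_ * _).
by rewrite [RHS](bigD1 k).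
Qed.

Let replaced_low (k : 'I_m) l : (l < k)%N -> replaced k (fun u => u ^+ l) = 0.
Proof.
move=> lk; pose l' := Ordinal (ltn_trans lk (ltn_ord k)).
pose A : 'M[F]_m := \matrix_(i, j) x j ^+ (if i == k then l else i).
transitivity (\det A).
  apply: eq_bigr => s _; congr (_ * _); rewrite [RHS](bigD1 k) //= mxE eqxx.
  by congr (_ * _); apply: eq_bigr => i /negPf ik; rewrite mxE ik.
have ll : l' != k by rewrite -val_eqE /= neq_ltn lk.
by apply: (determinant_alternate ll) => j; rewrite !mxE eqxx (negPf ll).
Qed.

Let replaced_succ (k : 'I_m) :
  replaced k (fun u => (u + 1) ^+ k.+1) =
  replaced k (fun u => u ^+ k.+1) + k.+1%:R * vdet x.
Proof.
transitivity (\sum_(l < k.+2) replaced k (fun u => u ^+ l) *+ 'C(k.+1, l)).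
  rewrite /replaced; under [RHS]eq_bigr do rewrite -sumrMnl.
  rewrite exchange_big; apply: eq_bigr => s _.
  rewrite [_ + 1]addrC exprDn mulr_suml mulr_sumr; apply: eq_bigr => l _.
  by rewrite expr1n mul1r mulrnAl mulrnAr.
rewrite !big_ord_recr /= binn mulr1n addrC binSn replaced_pow mulr_natl.
rewrite big1 ?add0r // => l _; rewrite replaced_low ?mul0rn //=.
Qed.

(** The left side replaces each power k in turn by (u + 1)^(k + 1). In the binomial expansion
    degrees below k repeat a row, degree k gives [k.+1] times the determinant, and degree k + 1,
    summed over k, gives the sum of the variables. *)
Lemma vdet_identity :
  \sum_(c < m) (x c + 1) * vdet (shift1 x c) =
  (\sum_(c < m) x c + \sum_(c < m) c.+1%:R) * vdet x.
Proof.
transitivity (\sum_k replaced k (fun u => (u + 1) ^+ k.+1)).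
  under eq_bigr do rewrite vdet_sum mulr_sumr.
  rewrite exchange_big [RHS]exchange_big; apply: eq_bigr => s _.
  rewrite (reindex_inj (@perm_inj _ s)); apply: eq_bigr => k _.
  rewrite mulrCA (bigD1 k) //= /shift1 eqxx exprS -mulrA; congr (_ * (_ * (_ * _))).
  apply: eq_bigr => i ik; rewrite -[_ == _ :> nat]/(_ == _ :> 'I_m).
  by rewrite (inj_eq perm_inj) (negPf ik) addr0.
under eq_bigr do rewrite replaced_succ.
rewrite big_split /= mulrDl mulr_suml; congr (_ + _); last by rewrite mulr_suml.
under [RHS]eq_bigr do rewrite vdet_sum mulr_sumr.
rewrite /replaced exchange_big [RHS]exchange_big /=; apply: eq_bigr => s _.
rewrite [RHS](reindex_inj (@perm_inj _ s)); apply: eq_bigr => k _.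
by rewrite [RHS]mulrCA [in RHS](bigD1 k) //= exprS !mulrA.
Qed.

End Determinant.

Lemma vdprod_det m x : vdprod m x =
  (\prod_(0 <= i < m) \prod_(i.+1 <= l < m) (-1)) *
  \det (Vandermonde m (\row_(j < m) x (j : nat)) : 'M[F]_m).
Proof.
rewrite det_Vandermonde /vdprod big_mkord [in RHS]big_mkord -big_split /=.
apply: eq_bigr => i _.
have -> : \prod_(j < m | (i < j)%N) ((\row_j0 x j0) 0 j - (\row_j0 x j0) 0 i) =
    \prod_(i.+1 <= l < m) (x l - x i).
  rewrite (big_nat_widenl _ 0) // big_mkord.
  by apply: eq_bigr => j _; rewrite !mxE.
by rewrite -big_split /=; apply: eq_bigr => l _; rewrite mulN1r opprB.
Qed.

Lemma vdprod_identity m x :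
  \sum_(c < m) (x c + 1) * vdprod m (shift1 x c) =
  (\sum_(c < m) x c + \sum_(c < m) c.+1%:R) * vdprod m x.
Proof.
under eq_bigr do rewrite vdprod_det mulrCA.
by rewrite -mulr_sumr vdet_identity vdprod_det mulrCA.
Qed.

Lemma vdprod_eq0 m x i l : (i < l < m)%N -> x i = x l -> vdprod m x = 0.
Proof.
move=> /andP[il lm] xil; have im := ltn_trans il lm.
rewrite /vdprod big_mkord (bigD1 (Ordinal im)) //=.
rewrite (big_nat_widenl _ 0) // big_mkord (bigD1 (Ordinal lm)) //= ?il //.
by rewrite xil subrr !mul0r.
Qed.

Lemma eq_vdprod m x y : (forall i, (i < m)%N -> x i = y i) -> vdprod m x = vdprod m y.
Proof.
move=> E; apply: eq_big_nat => i /andP[_ im]; apply: eq_big_nat => l /andP[_ lm].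
by rewrite !E.
Qed.

End VandermondeIdentity.

(** * Rows, columns and the addition of a box *)

Lemma ltn_col_len n la i j : young_diagram n la ->
  (i < col_len la j.+1)%N = (j < nth 0%N la i)%N.
Proof.
case/and3P => la_s _ _; rewrite /col_len.
elim: la la_s i => [|x s IH] la_s i; first by rewrite nth_nil.
have tr : transitive geq by move=> a b c ba ac; apply: leq_trans ac ba.
have /= := la_s; rewrite path_sortedE // => /andP[/allP s_x s_s] /=.
have [jx|xj] := ltnP j x.
  by case: i => [|i] //=; rewrite add1n ltnS IH.
have c0 : count (fun r => j < r)%N s = 0%N.
  apply/eqP; rewrite eqn0Ngt -has_count; apply/hasPn => r /s_x rx.
  by rewrite -leqNgt (leq_trans rx).
rewrite c0 addn0 ltn0; apply/esym/negbTE; rewrite -leqNgt.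
case: i => //= i; have [i_s|?] := ltnP i (size s); last by rewrite nth_default.
by apply: leq_trans (s_x _ (mem_nth _ i_s)) xj.
Qed.

Lemma col_len_sum la j N : (size la <= N)%N ->
  col_len la j.+1 = (\sum_(i < N) (j < nth 0%N la i))%N.
Proof.
rewrite /col_len; elim: N la => [|N IH] [|x s] //= sN; rewrite ?big_ord0 //.
  by rewrite big1 // => i _; rewrite nth_nil.
by rewrite big_ord_recl /= (IH s).
Qed.

Lemma col_len_incr la c j : col_len (incr_nth la c) j.+1 =
  (col_len la j.+1 + (nth 0%N la c == j))%N.
Proof.
pose N := (size la + c).+1.
rewrite (@col_len_sum _ _ N) ?(@col_len_sum la _ N); last 2 first.
- by rewrite /N; lia.
- by rewrite size_incr_nth /N; case: ifP; lia.
have cN : (c < N)%N by rewrite /N; lia.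
rewrite (bigD1 (Ordinal cN)) //= [in RHS](bigD1 (Ordinal cN)) //=.
rewrite nth_incr_nth eqxx add1n ltnS leq_eqVlt addnAC; congr (_ + _)%N.
  by rewrite eq_sym; case: ltngtP.
apply: eq_bigr => i; rewrite -val_eqE /= nth_incr_nth eq_sym => /negPf ->.
by rewrite add0n.
Qed.

Lemma sum_ltn m v : (\sum_(j < m) (j < v) = minn m v)%N.
Proof.
elim: m => [|m IH]; first by rewrite big_ord0 min0n.
by rewrite big_ord_recr /= IH; case: ltnP; lia.
Qed.

Section Coherence.
Variables (R : realType) (p q : nat).
Hypothesis pq : (p, q) <> (0%N, 0%N).
Local Notation C := R[i].

Lemma in_YE n la : young_diagram n la ->
  in_Y p q la = ((p == 0)%N || (q <= nth 0%N la p.-1)%N) && (nth 0%N la p <= q)%N.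
Proof.
move=> la_d; have [_ la_p _] := young_diagramP _ _ la_d.
rewrite /in_Y /has_box /row_len /=; case: (eqVneq q 0%N) => [->|q0].
  rewrite leq0n orbT leqn0 /=; apply/idP/eqP => [|la0]; first exact: nth_default.
  by rewrite leqNgt; apply/negP => /la_p; rewrite la0.
case: (eqVneq p 0%N) => [->//|p0] /=.
by rewrite !lt0n p0 q0 /= -ltnNge ltnS.
Qed.

(** The common shift does not affect the differences; it makes [row_coord la c + 1] equal to p - q
    plus the content of a box added to row [c], and [col_coord la j + 1] its opposite for a box
    added to column [j]. *)
Definition row_coord la i : int := (nth 0%N la i)%:Z - q%:Z + p%:Z - 1 - i%:Z.
Definition col_coord la j : int := (col_len la j.+1)%:Z - p%:Z + q%:Z - 1 - j%:Z.
Definition minus_size la : int := \sum_(j < q) ((col_len la j.+1)%:Z - p%:Z).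

Definition vd_part la : C :=
  if in_Y p q la then (-1) ^ minus_size la *
    (vdprod p (row_coord la) * vdprod q (col_coord la))%:~R else 0.

Local Notation k2 := (`|p%:Z - q%:Z| ^ 2)%N.
Local Notation N0 := (p ^ 2 + q ^ 2 - p * q)%N.

Definition pref n : C := sqrtC ((k2 + n - 1)`! * n`!)%:R / ((N0 + n - 1)`!)%:R.

Lemma f_pqE n la : in_Y p q la -> f_pq R p q n la = pref n * vd_part la.
Proof.
move=> la_Y; rewrite /f_pq /vd_part la_Y /pref intrM /minus_size.
have -> : \sum_(1 <= l < q.+1) lam_minus p la l =
    \sum_(j < q) ((col_len la j.+1)%:Z - p%:Z).
  by rewrite big_add1 big_mkord.
have -> : \prod_(1 <= i < p.+1) \prod_(i.+1 <= l < p.+1)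
    (lam_plus q la i - lam_plus q la l + l%:Z - i%:Z) = vdprod p (row_coord la).
  rewrite big_add1 /=; apply: eq_bigr => i _; rewrite big_add1 /=.
  apply: eq_bigr => l _; rewrite /lam_plus /row_coord /row_len /=; lia.
have -> : \prod_(1 <= r < q.+1) \prod_(r.+1 <= s < q.+1)
    (lam_minus p la r - lam_minus p la s + s%:Z - r%:Z) = vdprod q (col_coord la).
  rewrite big_add1 /=; apply: eq_bigr => i _; rewrite big_add1 /=.
  apply: eq_bigr => l _; rewrite /lam_minus /col_coord /=; lia.
by rewrite [RHS]mulrCA !mulrA.
Qed.

(** Below row p the rows have at most q boxes, so these lie in the first q columns, each of which
    has p boxes above them. *)
Lemma diagram_split n la : young_diagram n la -> in_Y p q la ->
  n%:Z = \sum_(i < p) (nth 0%N la i)%:Z + minus_size la.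
Proof.
move=> la_d; rewrite (in_YE la_d) => /andP[la_pq la_p].
have la_s := diagram_size la_d.
have nE : n = (\sum_(i < p + n) nth 0%N la i)%N.
  by rewrite -sumn_nth ?(diagram_sumn la_d) // (leq_trans la_s) ?leq_addl.
have rowq i : (i < p)%N -> (q <= nth 0%N la i)%N.
  move=> ip; case/orP: la_pq => [/eqP p0|]; first by rewrite p0 in ip.
  by move/leq_trans; apply; apply: (nth_diagram_le la_d); lia.
have colE (j : 'I_q) :
    (col_len la j.+1 = p + \sum_(i < n) (j < nth 0%N la (p + i)))%N.
  rewrite (@col_len_sum _ _ (p + n)) ?(leq_trans la_s) ?leq_addl //.
  rewrite big_split_ord /=; congr (_ + _)%N.
  rewrite -[RHS](card_ord p) -sum1_card; apply: eq_bigr => i _.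
  by rewrite (leq_trans (ltn_ord j) (rowq _ (ltn_ord i))).
have leq_q i : (nth 0%N la (p + i) <= q)%N.
  by apply: leq_trans la_p; apply: (nth_diagram_le la_d); apply: leq_addr.
transitivity ((\sum_(i < p) nth 0%N la i +
    \sum_(j < q) \sum_(i < n) (j < nth 0%N la (p + i))) : nat)%N%:Z.
  congr Posz; rewrite {1}nE big_split_ord /=; congr (_ + _)%N.
  by rewrite exchange_big; apply: eq_bigr => i _; rewrite sum_ltn (minn_idPr _).
rewrite PoszD !(big_morph Posz PoszD (erefl _)) /minus_size; congr (_ + _).
by apply: eq_bigr => j _; rewrite colE PoszD addrAC subrr add0r.
Qed.

Section AddBox.
Variables (n : nat) (la : seq nat).
Hypothesis la_d : young_diagram n la.

Definition addable c := (c == 0)%N || (nth 0%N la c < nth 0%N la c.-1)%N.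

Lemma young_incr c : young_diagram n.+1 (incr_nth la c) = addable c.
Proof.
have [la_s la_p la_n] := young_diagramP _ _ la_d; apply/idP/idP => [inc_d|c_add].
  rewrite /addable; case: (eqVneq c 0%N) => //= c0.
  have := nth_diagram_le inc_d (leq_pred c); rewrite !nth_incr_nth eqxx.
  by rewrite (negPf (_ : c != c.-1)) //; lia.
have c_le : (c <= size la)%N.
  rewrite leqNgt; apply/negP => c_gt; move: c_add; rewrite /addable.
  by rewrite [nth _ _ c.-1]nth_default; lia.
apply/young_diagramP; split.
- move=> i; rewrite !nth_incr_nth; have := la_s i.
  have [ci|] := eqVneq c i.+1; last by lia.
  by move: c_add; rewrite /addable ci /=; lia.
- move=> i; rewrite size_incr_nth nth_incr_nth => i_lt.
  have [//|ci] := eqVneq c i; rewrite add0n; apply: la_p.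
  by move: i_lt; case: ifP; lia.
- by rewrite sumn_incr_nth la_n.
Qed.

Hypothesis la_Y : in_Y p q la.

Let la_pq : ((p == 0)%N || (q <= nth 0%N la p.-1)%N) && (nth 0%N la p <= q)%N.
Proof. by rewrite -(in_YE la_d). Qed.

Lemma row_ge_q c : (c < p)%N -> (q <= nth 0%N la c)%N.
Proof.
move=> cp; case/andP: la_pq => /orP[/eqP p0|+] _; first by rewrite p0 in cp.
by move/leq_trans; apply; apply: (nth_diagram_le la_d); lia.
Qed.

Lemma row_le_q c : (p <= c)%N -> (nth 0%N la c <= q)%N.
Proof.
by case/andP: la_pq => _ la_p pc; apply: leq_trans la_p; apply: (nth_diagram_le la_d).
Qed.

Local Notation x := (row_coord la).
Local Notation y := (col_coord la).

Let content_box c : C := (p%:Z - q%:Z)%:~R + (nth 0%N la c)%:R - c%:R.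

Let term c : C := if young_diagram n.+1 (incr_nth la c)
  then content_box c * vd_part (incr_nth la c) else 0.

Let rowterm c : int := (x c + 1) * vdprod p (shift1 x c) * vdprod q y.
Let colterm j : int := (y j + 1) * vdprod p x * vdprod q (shift1 y j).
Let sg : C := (-1) ^ minus_size la.

(** No condition of addability remains on the right: if row [c] is as long as row [c.-1], the
    shifted coordinates of the two coincide and the product vanishes. *)
Lemma term_row c : (c < p)%N -> term c = sg * (rowterm c)%:~R.
Proof.
move=> cp; rewrite /term young_incr; case: ifPn => [c_add|].
  have inc_d : young_diagram n.+1 (incr_nth la c) by rewrite young_incr.
  have la_c := row_ge_q cp.
  have inc_Y : in_Y p q (incr_nth la c).
    rewrite (in_YE inc_d) !nth_incr_nth; case/andP: la_pq => /orP la1 la2.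
    rewrite (negPf (_ : c != p)) ?add0n ?la2 ?andbT; last by lia.
    by case: la1 => [->//|la1]; rewrite (leq_trans la1) ?leq_addl ?orbT.
  have colE (j : nat) : (j < q)%N -> col_len (incr_nth la c) j.+1 = col_len la j.+1.
    by move=> jq; rewrite col_len_incr (negPf (_ : _ != j)) ?addn0 //; lia.
  rewrite /vd_part inc_Y.
  have -> : minus_size (incr_nth la c) = minus_size la.
    by apply: eq_bigr => j _; rewrite colE.
  have -> : vdprod q (col_coord (incr_nth la c)) = vdprod q y.
    by apply: eq_vdprod => j jq; rewrite /col_coord colE.
  have -> : vdprod p (row_coord (incr_nth la c)) = vdprod p (shift1 x c).
    apply: eq_vdprod => i _; rewrite /shift1 /row_coord nth_incr_nth PoszD.
    by rewrite eq_sym natz; lia.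
  rewrite mulrCA; congr (_ * _); rewrite /rowterm -mulrA [RHS]intrM; congr (_ * _).
  rewrite /content_box -[(nth _ _ _)%:R]/((nth 0%N la c)%:Z%:~R) -[c%:R]/(c%:Z%:~R).
  by rewrite -intrD -intrB /row_coord; congr (_%:~R); lia.
rewrite negb_or -leqNgt => /andP[c0 la_c].
rewrite /rowterm (@vdprod_eq0 _ p _ c.-1 c); first by rewrite mulr0 mul0r mulr0.
  by lia.
have := nth_diagram_le la_d (leq_pred c).
by rewrite /shift1 /row_coord eqxx (negPf (_ : c.-1 != c)) ?addr0; lia.
Qed.

(** Written as a sum over columns, with at most one nonzero term, so that the sum over the rows
    below p can be exchanged into a sum over the first q columns. *)
Lemma term_col c : (p <= c)%N ->
  term c = \sum_(j < q) ((nth 0%N la c == j) && (col_len la j.+1 == c))%:R *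
     (sg * (colterm j)%:~R).
Proof.
move=> pc; rewrite /term young_incr; have la_c := row_le_q pc.
have [la_q|q_la] := ltnP (nth 0%N la c) q; last first.
  rewrite [RHS]big1 => [|j _]; last first.
    by rewrite (negPf (_ : nth 0%N la c != j)) ?mul0r //; have := ltn_ord j; lia.
  case: ifPn => // c_add.
  (* Row p has length q here, so the new box is (p + 1, q + 1), counted from 1, and the larger
     diagram is outside Y(p, q). *)
  have c_p : c = p.
    apply/eqP; rewrite eqn_leq pc andbT leqNgt; apply/negP => p_c.
    move: c_add; rewrite /addable; have := @row_le_q c.-1; lia.
  have inc_d : young_diagram n.+1 (incr_nth la c) by rewrite young_incr.
  have inc_nY : in_Y p q (incr_nth la c) = false.
    rewrite (in_YE inc_d) -c_p [nth _ _ c]nth_incr_nth eqxx add1n.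
    by apply/negbTE; rewrite negb_and -ltnNge ltnS q_la orbT.
  by rewrite /vd_part inc_nY mulr0.
pose j0 := Ordinal la_q.
have colP i : (i < col_len la (nth 0%N la c).+1)%N = (nth 0%N la c < nth 0%N la i)%N.
  exact: ltn_col_len la_d.
case: ifPn => [c_add|]; last first.
  rewrite negb_or -leqNgt => /andP[c0 la_c1].
  rewrite big1 // => j _; case: eqP => [jE|]; last by rewrite mul0r.
  rewrite -jE; case: eqP => [cE|]; last by rewrite mul0r.
  have := colP c.-1; rewrite cE; lia.
have inc_d : young_diagram n.+1 (incr_nth la c) by rewrite young_incr.
have col_c : col_len la (nth 0%N la c).+1 = c.
  apply/eqP; rewrite eqn_leq; apply/andP; split.
    by rewrite leqNgt colP ltnn.
  move: c_add; rewrite /addable; case: (posnP c) => [->//|c0].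
  by have := colP c.-1; lia.
rewrite (bigD1 j0) //= eqxx col_c eqxx mul1r big1 ?addr0; last first.
  by move=> j; rewrite -val_eqE /= eq_sym => /negPf ->; rewrite mul0r.
have inc_Y : in_Y p q (incr_nth la c).
  rewrite (in_YE inc_d) !nth_incr_nth; case/andP: la_pq => /orP la1 la2.
  apply/andP; split.
    by case: la1 => [->//|la1]; rewrite (leq_trans la1) ?leq_addl ?orbT.
  by case: eqP => [<-|_]; lia.
rewrite /vd_part inc_Y.
have -> : minus_size (incr_nth la c) = minus_size la + 1.
  rewrite /minus_size (bigD1 j0) //= [in RHS](bigD1 j0) //= col_len_incr eqxx.
  under eq_bigr => j jj0.
    rewrite col_len_incr (_ : (nth 0%N la c == j) = false) ?addn0; last first.
      by apply/negbTE; rewrite eq_sym -(inj_eq val_inj) in jj0 *.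
    over.
  rewrite /=; lia.
have -> : vdprod q (col_coord (incr_nth la c)) = vdprod q (shift1 y j0).
  apply: eq_vdprod => j jq; rewrite /shift1 /col_coord col_len_incr PoszD.
  by rewrite eq_sym natz /=; lia.
have -> : vdprod p (row_coord (incr_nth la c)) = vdprod p x.
  apply: eq_vdprod => i ip; rewrite /row_coord nth_incr_nth.
  by rewrite (negPf (_ : c != i)) //; lia.
(* The sign in f_pq originates here: the box changes the parity of |la^-|, which offsets the minus
   sign in p - q + content = - (y j0 + 1). *)
rewrite exprzDr ?unitrN1 // expr1z -/sg.
have -> : content_box c = - (y j0 + 1)%:~R.
  rewrite /content_box -[(nth _ _ _)%:R]/((nth 0%N la c)%:Z%:~R) -[c%:R]/(c%:Z%:~R).
  by rewrite -intrD -intrB -rmorphN /= /col_coord /= col_c; congr (_%:~R); lia.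
by rewrite /colterm !intrM; ring.
Qed.

Lemma colterm_eq0 (j : nat) : (j < q)%N ->
  (nth 0%N la (col_len la j.+1) != j)%N -> colterm j = 0.
Proof.
move=> jq ne.
have lt_j : (nth 0%N la (col_len la j.+1) < j)%N.
  have := ltn_col_len (col_len la j.+1) j la_d; rewrite ltnn => /esym/negbT.
  by rewrite -leqNgt; lia.
have col_eq : col_len la j.-1.+1 = col_len la j.+1.
  apply/eqP; rewrite eqn_leq; apply/andP; split.
    rewrite leqNgt (ltn_col_len _ _ la_d); lia.
  rewrite leqNgt; apply/negP => lt_col.
  have := ltn_col_len (col_len la j.-1.+1) j la_d.
  have := ltn_col_len (col_len la j.-1.+1) j.-1 la_d.
  by rewrite ltnn lt_col; lia.
rewrite /colterm (@vdprod_eq0 _ q _ j.-1 j) ?mulr0 //; first by lia.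
rewrite /shift1 /col_coord eqxx col_eq (negPf (_ : j.-1 != j)) ?addr0 //; lia.
Qed.

Lemma col_len_bounds (j : nat) : (j < q)%N ->
  (p <= col_len la j.+1)%N && (col_len la j.+1 <= n)%N.
Proof.
move=> jq; apply/andP; split.
  case: (posnP p) => [->//|p0].
  have := ltn_col_len p.-1 j la_d; have := @row_ge_q p.-1; lia.
apply: leq_trans (diagram_size la_d); apply: count_size.
Qed.

Lemma sum_term : \sum_(c < n.+1) term c = (N0 + n)%:R * vd_part la.
Proof.
transitivity (\sum_(c < p + n.+1) term c).
  rewrite addnC big_split_ord /= [X in _ = _ + X]big1 ?addr0 // => c _.
  rewrite /term young_incr /addable /= !nth_default //; last 2 first.
  - by have := diagram_size la_d; lia.
  - by have := diagram_size la_d; lia.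
rewrite big_split_ord /=.
have -> : \sum_(c < p) term c = sg * (\sum_(c < p) rowterm c)%:~R.
  by rewrite rmorph_sum mulr_sumr; apply: eq_bigr => c _; rewrite term_row.
have -> : \sum_(i < n.+1) term (p + i) = sg * (\sum_(j < q) colterm j)%:~R.
  under eq_bigr do rewrite term_col ?leq_addr //.
  rewrite exchange_big rmorph_sum mulr_sumr; apply: eq_bigr => j _ /=.
  rewrite -mulr_suml; have [la_j|] := eqVneq (nth 0%N la (col_len la j.+1)) j; last first.
    by move/(colterm_eq0 (ltn_ord j)) => ->; rewrite mulr0 mulr0.
  have /andP[p_col col_n] := col_len_bounds (ltn_ord j).
  have i_lt : (col_len la j.+1 - p < n.+1)%N by lia.
  rewrite (bigD1 (Ordinal i_lt)) //= subnKC // eqxx la_j eqxx big1 ?addr0 ?mul1r //.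
  move=> i; rewrite -val_eqE /= => i_ne.
  by rewrite [_ == (p + i)%N](negPf _) ?andbF //; lia.
rewrite -mulrDr -intrD /vd_part la_Y -/sg mulrCA; congr (_ * _).
rewrite -[(N0 + n)%:R]/((N0 + n)%:Z%:~R) -intrM; congr (_%:~R).
have -> : \sum_(c < p) rowterm c =
    (\sum_(c < p) x c + \sum_(c < p) c.+1%:R) * vdprod p x * vdprod q y.
  by rewrite -vdprod_identity mulr_suml.
have -> : \sum_(j < q) colterm j =
    (\sum_(j < q) y j + \sum_(j < q) j.+1%:R) * vdprod q y * vdprod p x.
  by rewrite -vdprod_identity mulr_suml; apply: eq_bigr => j _; rewrite mulrAC.
rewrite -!big_split /=.
(* These two sums, with [diagram_split], produce n + p (p - q) + q^2. *)
have -> : \sum_(i < p) (x i + i.+1%:R) =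
    \sum_(i < p) (nth 0%N la i)%:Z + p%:Z * (p%:Z - q%:Z).
  transitivity (\sum_(i < p) ((nth 0%N la i)%:Z + (p%:Z - q%:Z))).
    by apply: eq_bigr => i _; rewrite /row_coord natz; lia.
  by rewrite big_split /= sumr_const card_ord -mulr_natl natz.
have -> : \sum_(i < q) (y i + i.+1%:R) = minus_size la + q%:Z * q%:Z.
  transitivity (\sum_(j < q) (((col_len la j.+1)%:Z - p%:Z) + q%:Z)).
    by apply: eq_bigr => i _; rewrite /col_coord natz; lia.
  by rewrite big_split /= sumr_const card_ord -mulr_natl natz.
have N0E : N0%:Z = p%:Z * p%:Z + q%:Z * q%:Z - p%:Z * q%:Z by nia.
by rewrite PoszD N0E (diagram_split la_d la_Y); ring.
Qed.

End AddBox.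

(** When [la] is outside Y(p, q) but the larger diagram is inside, the new box is (p, q), of content
    q - p, and the factor is 0. *)
Lemma sum_add_box n la : young_diagram n la ->
  \sum_(c < n.+1) (if young_diagram n.+1 (incr_nth la c)
    then ((p%:Z - q%:Z)%:~R + (nth 0%N la c)%:R - c%:R) * vd_part (incr_nth la c)
    else 0) = (N0 + n)%:R * vd_part la.
Proof.
move=> la_d; have [la_Y|la_nY] := boolP (in_Y p q la); first exact: sum_term.
rewrite {2}/vd_part (negPf la_nY) mulr0 big1 // => c _.
case: ifP => // inc_d; rewrite /vd_part; case: ifP => [inc_Y|]; last by rewrite mulr0.
move: la_nY inc_Y; rewrite (in_YE la_d) (in_YE inc_d) !nth_incr_nth.
rewrite negb_and negb_or => + /andP[inc1 inc2].
rewrite (leq_trans (leq_addl _ _) inc2) orbF -ltnNge => /andP[p0 la_p].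
have cE : c = p.-1 :> nat.
  by move: inc1; rewrite (negPf p0) /=; case: eqP => //; lia.
have laE : nth 0%N la p.-1 = q.-1.
  by move: inc1; rewrite (negPf p0) /= cE eqxx; lia.
rewrite cE laE -[(q.-1)%:R]/(q.-1%:Z%:~R) -[(p.-1)%:R]/(p.-1%:Z%:~R) -intrD -intrB.
by rewrite (_ : _ - _ = 0 :> int) ?mul0r //; lia.
Qed.

Lemma k2E : `|(p%:Z - q%:Z)%:~R : C| ^+ 2 = k2%:R.
Proof. by rewrite -intr_norm -abszE -[(`|_|%:Z)%:~R]/(`|_|%:R) -natrX. Qed.

Lemma pref_succ n : (0 < n)%N ->
  sqrtC (n.+1%:R / (k2%:R + n%:R)) / n.+1%:R * pref n.+1 * (N0 + n)%:R = pref n.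
Proof.
case: n => // n _; rewrite /pref !addnS !subn1 /=.
set a := (k2 + n)`!; set b := (N0 + n)`!.
have nz (m : nat) : (m.+1%:R : C) != 0 by rewrite pnatr_eq0.
have ge0 (m : nat) : (m%:R : C) \is Num.nneg by rewrite nnegrE ler0n.
set s := sqrtC (n.+2%:R / _); set t := sqrtC ((k2 + n).+1`! * _)%:R.
have E : s * t = sqrtC (a * n.+1`!)%:R * n.+2%:R.
  rewrite /s /t -sqrtCM ?nnegrE ?divr_ge0 -?natrD ?ler0n //.
  have -> : n.+2%:R / (k2 + n.+1)%:R * ((k2 + n).+1`! * n.+2`!)%:R =
      (a * n.+1`!)%:R * n.+2%:R ^+ 2 :> C.
    rewrite factS [n.+2`!]factS -/a !natrM; move: (nz (k2 + n)%N).
    by rewrite -addnS; move: (_%:R : C) => X X0; field.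
  by rewrite sqrtCM ?nnegrE ?exprn_ge0 ?ler0n // sqrCK ?ler0n.
have b0 : (b%:R : C) != 0 by rewrite pnatr_eq0 -lt0n fact_gt0.
rewrite factS -/b natrM; move: E (nz n.+1) (nz (N0 + n)%N) b0.
move: s t (sqrtC _) (n.+2%:R) ((N0 + n).+1%:R) (b%:R) => s t u d m v E d0 m0 v0.
by rewrite -[u](mulfK d0) -E; field; rewrite d0 m0 v0.
Qed.

Lemma pref_ge0 n : 0 <= pref n.
Proof. by rewrite /pref divr_ge0 ?sqrtC_ge0 ?ler0n. Qed.

Definition f_block n la : C := pref n * vd_part la.

Lemma f_block_coherent : coherent (p%:Z - q%:Z)%:~R f_block.
Proof.
move=> n la n0 la_d; rewrite k2E /f_block -(pref_succ n0).
rewrite -[LHS]mulrA -(sum_add_box la_d) -[LHS]mulrA; congr (_ * _).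
rewrite mulr_sumr; apply: eq_bigr => c _.
case: ifP; rewrite ?mulr0 // => _.
rewrite (_ : ((p%:Z - q%:Z)%:~R : C)^* = (p%:Z - q%:Z)%:~R); last first.
  by rewrite rmorph_int.
by rewrite mulrCA.
Qed.

End Coherence.

(** * Boundedness *)

Lemma fact_addl_ge a m n : (n <= a.+1)%N -> (a`! * n ^ m <= (a + m)`!)%N.
Proof.
move=> na; elim: m => [|m IH]; first by rewrite muln1 addn0.
rewrite addnS factS expnSr mulnA mulnC leq_mul //.
by apply: leq_trans na _; rewrite ltnS leq_addr.
Qed.

(** The number m (m - 1) / 2 of factors of [vdprod m]. *)
Definition tri m := (\sum_(i < m) (m - i.+1))%N.

Lemma tri2 m : (tri m * 2 = m * m.-1)%N.
Proof.
elim: m => [|m IH]; first by rewrite /tri big_ord0.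
rewrite /tri big_ord_recl /= subSS subn0.
under eq_bigr do rewrite /bump /= add1n subSS.
by rewrite mulnDl -/(tri m) IH; case: m {IH} => //= m; lia.
Qed.

Lemma vdprod_bound m (x : nat -> int) (B : nat) :
  (forall i l, (i < m)%N -> (l < m)%N -> `|x i - x l| <= B%:Z) ->
  `|vdprod m x| <= (B ^ tri m)%:Z.
Proof.
move=> xB; rewrite /vdprod normr_prod /tri.
rewrite big_mkord -(natz (B ^ _)) natrX -prodrXr.
apply: ler_prod => i _; rewrite normr_ge0 normr_prod -prodr_const_nat natz.
rewrite !big_seq; apply: ler_prod => l; rewrite mem_index_iota => /andP[il lm].
by rewrite normr_ge0 xB.
Qed.

Lemma leq_expl a b m : (a <= b)%N -> (a ^ m <= b ^ m)%N.
Proof. by move=> ab; elim: m => // m IH; rewrite !expnS leq_mul. Qed.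

Section Bound.
Variables (R : realType) (p q : nat).
Hypothesis pq : (p, q) <> (0%N, 0%N).
Local Notation C := R[i].

Lemma nth_le_size n la i : young_diagram n la -> (nth 0%N la i <= n)%N.
Proof.
move=> la_d; rewrite -(diagram_sumn la_d) (@sumn_nth _ (size la + i.+1)) ?leq_addr //.
have i_lt : (i < size la + i.+1)%N by lia.
by rewrite (bigD1 (Ordinal i_lt)) //= leq_addr.
Qed.

Lemma col_len_le n la j : young_diagram n la -> (col_len la j.+1 <= n)%N.
Proof. by move=> la_d; apply: leq_trans (diagram_size la_d); apply: count_size. Qed.

Lemma vd_part_bound n la : young_diagram n la ->
  `|vd_part R p q la| <= ((n + p + q) ^ (tri p + tri q))%:R.
Proof.
move=> la_d; rewrite /vd_part; case: ifP => _; last by rewrite normr0 ler0n.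
have norm_sg (k : int) : `|(-1) ^ k : C| = 1.
  by case: k => k; rewrite /exprz ?normfV normrX normrN1 expr1n ?invr1.
rewrite normrM norm_sg mul1r -intr_norm normrM.
rewrite -[X in _ <= X]/((((n + p + q) ^ (tri p + tri q))%N : int)%:~R).
rewrite ler_int expnD PoszM ler_pM //; apply: vdprod_bound => i l i_lt l_lt.
  have := nth_le_size i la_d; have := nth_le_size l la_d; rewrite /row_coord.
  by rewrite ler_norml; lia.
have := col_len_le i la_d; have := col_len_le l la_d; rewrite /col_coord.
by rewrite ler_norml; lia.
Qed.

(* A diagram in [Y(p, q)] is determined by its first [p] rows and its first
   [q] columns, whose total length is [n + p * q]. *)
Let key la i : nat := if (i < p)%N then nth 0%N la i else col_len la (i - p).+1.

Lemma key_le n la i : young_diagram n la -> (key la i <= n)%N.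
Proof. by rewrite /key; case: ifP => _ la_d; [apply: nth_le_size | apply: col_len_le]. Qed.

Lemma sum_key n la : young_diagram n la -> in_Y p q la ->
  (\sum_(i < p + q) key la i = n + p * q)%N.
Proof.
move=> la_d la_Y; have := diagram_split la_d la_Y; rewrite /minus_size.
rewrite big_split_ord /=.
have -> : (\sum_(i < p) key la i = \sum_(i < p) nth 0%N la i)%N.
  by apply: eq_bigr => i _; rewrite /key ltn_ord.
have -> : (\sum_(i < q) key la (p + i) = \sum_(j < q) col_len la j.+1)%N.
  by apply: eq_bigr => i _; rewrite /key ltnNge leq_addr addKn.
rewrite sumrB sumr_const card_ord -mulr_natl natz => H.
apply/eqP; rewrite -eqz_nat !PoszD !(big_morph Posz PoszD (erefl _)) H; apply/eqP.
rewrite PoszM; ring.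
Qed.

Lemma key_inj n la mu : young_diagram n la -> young_diagram n mu ->
  in_Y p q la -> in_Y p q mu ->
  (forall i, (i < (p + q).-1)%N -> key la i = key mu i) -> la = mu.
Proof.
move=> la_d mu_d la_Y mu_Y key_eq.
have pq0 : (0 < p + q)%N.
  by rewrite addn_gt0 !lt0n -negb_and; apply: contra_notN pq => /andP[/eqP -> /eqP ->].
(* The total of the keys is fixed, so the last one is redundant; this saves the power of n that
   makes the final estimate balance. *)
have {}key_eq i : (i < p + q)%N -> key la i = key mu i.
  move=> i_lt; have [/key_eq //|le_i] := ltnP i (p + q).-1.
  have -> : i = (p + q).-1 by lia.
  have := sum_key la_d la_Y; rewrite -(sum_key mu_d mu_Y).
  rewrite -(prednK pq0) !big_ord_recr /= => E.
  move: E; have -> : (\sum_(i < (p + q).-1) key la i = \sum_(i < (p + q).-1) key mu i)%N.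
    by apply: eq_bigr => k _; rewrite key_eq.
  by move/addnI.
have row_eq i : (i < p)%N -> nth 0%N la i = nth 0%N mu i.
  by move=> ip; have := key_eq i (ltn_addr _ ip); rewrite /key ip.
have col_eq j : (j < q)%N -> col_len la j.+1 = col_len mu j.+1.
  move=> jq; have := key_eq (p + j)%N; rewrite ltn_add2l jq => /(_ isT).
  by rewrite /key ltnNge leq_addr addKn.
apply: (diagram_inj la_d mu_d) => i; have [/row_eq //|pi] := ltnP i p.
have la_q := row_le_q la_d la_Y pi; have mu_q := row_le_q mu_d mu_Y pi.
rewrite -(minn_idPr la_q) -(minn_idPr mu_q) -!sum_ltn; apply: eq_bigr => j _.
by rewrite -(ltn_col_len _ _ la_d) -(ltn_col_len _ _ mu_d) col_eq.
Qed.

Lemma count_block n :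
  (size [seq la <- diagrams n | in_Y p q la] <= n.+1 ^ (p + q).-1)%N.
Proof.
set s := [seq _ <- _ | _].
have s_d la : la \in s -> young_diagram n la /\ in_Y p q la.
  by rewrite mem_filter mem_diagrams => /andP[].
pose h la : {ffun 'I_(p + q).-1 -> 'I_n.+1} := [ffun i : 'I__ => inord (key la i)].
have s_u : uniq (map h s).
  rewrite map_inj_in_uniq ?filter_uniq ?undup_uniq //.
  move=> la mu /s_d[la_d la_Y] /s_d[mu_d mu_Y] /ffunP E.
  apply: (key_inj la_d mu_d) => // i i_lt.
  have := E (Ordinal i_lt); rewrite !ffunE => /(congr1 val).
  by rewrite /= !inordK ?ltnS ?(key_le _ la_d) ?(key_le _ mu_d).
rewrite -(size_map h) -(card_uniqP s_u).
by apply: leq_trans (max_card _) _; rewrite card_ffun !card_ord.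
Qed.

Local Notation k2 := (`|p%:Z - q%:Z| ^ 2)%N.
Local Notation N0 := (p ^ 2 + q ^ 2 - p * q)%N.
Local Notation e := (p ^ 2 + q ^ 2 - 1)%N.

(** The squared prefactor is at most n^(-e): raising the factorial argument from k2 + n - 1 to N0 +
    n - 1 gains n^(p q), raising it from n gains n^(N0 - 1). *)
Lemma pref_fact_bound n : (0 < n)%N ->
  ((k2 + n - 1)`! * n`! * n ^ e <= (N0 + n - 1)`! ^ 2)%N.
Proof.
move=> n0; have pq0 : (0 < p ^ 2 + q ^ 2)%N.
  rewrite addn_gt0 !expn_gt0 !orbF !lt0n -negb_and.
  by apply: contra_notN pq => /andP[/eqP -> /eqP ->].
have k2E : (k2 + p * q = N0)%N.
  have -> : `|p%:Z - q%:Z|%N = (p - q + (q - p))%N by lia.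
  by have [pq_le|pq_le] := leqP p q; nia.
have N0_gt0 : (0 < N0)%N by nia.
have H1 := @fact_addl_ge (k2 + n - 1) (p * q) n.
have H2 := @fact_addl_ge n (N0 - 1) n.
rewrite (_ : (k2 + n - 1 + p * q = N0 + n - 1)%N) in H1; last by lia.
rewrite (_ : (n + (N0 - 1) = N0 + n - 1)%N) in H2; last by lia.
have eE : (e = p * q + (N0 - 1))%N.
  have pq_le : (p * q <= p ^ 2 + q ^ 2)%N by nia.
  by clear - pq_le N0_gt0; move: pq_le N0_gt0; move: (p * q)%N (p ^ 2 + q ^ 2)%N; lia.
rewrite expnS expn1 eE.
rewrite expnD mulnACA leq_mul // ?H1 ?H2 //; lia.
Qed.

Lemma f_block_bound : exists K : nat, forall n, (0 < n)%N ->
  \sum_(la <- diagrams n) `|f_block R p q n la| ^+ 2 <= K%:R.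
Proof.
(* The constant comes from n + p + q <= n (1 + p + q). *)
exists ((1 + p + q) ^ e)%N => n n0.
have pq0 : (0 < p + q)%N.
  by rewrite addn_gt0 !lt0n -negb_and; apply: contra_notN pq => /andP[/eqP -> /eqP ->].
pose B := (n + p + q)%N; pose t := (tri p + tri q)%N.
pose c := (N0 + n - 1)`!; pose A := ((k2 + n - 1)`! * n`!)%N.
have c0 : (0 : C) < c%:R ^+ 2 by rewrite exprn_gt0 // ltr0n fact_gt0.
have term_le la : young_diagram n la ->
    `|f_block R p q n la| ^+ 2 <= (A * (B ^ t) ^ 2)%:R / c%:R ^+ 2.
  move=> la_d; rewrite /f_block normrM (ger0_norm (pref_ge0 _ _ _ _)) exprMn.
  have -> : pref R p q n ^+ 2 = A%:R / c%:R ^+ 2.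
    by rewrite /pref exprMn exprVn sqrtCK.
  rewrite natrM natrX [leRHS]mulrAC.
  rewrite ler_wpM2l ?divr_ge0 ?ler0n ?exprn_ge0 //.
  by rewrite lerXn2r ?nnegrE ?normr_ge0 ?ler0n // vd_part_bound.
rewrite (bigID (in_Y p q)) /= [X in _ + X]big1 ?addr0; last first.
  by move=> la /negPf la_nY; rewrite /f_block /vd_part la_nY mulr0 normr0 expr0n.
rewrite -big_filter.
apply: (@le_trans _ _ (\sum_(la <- [seq la <- diagrams n | in_Y p q la])
    (A * (B ^ t) ^ 2)%:R / c%:R ^+ 2)).
  rewrite !big_seq; apply: ler_sum => la.
  by rewrite mem_filter mem_diagrams => /andP[_ /term_le].
rewrite big_const_seq iter_addr_0 count_predT -[leLHS]mulr_natr [leLHS]mulrAC.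
rewrite ler_pdivrMr //.
rewrite -natrX -!natrM ler_nat.
have count_le := count_block n; have fact_le := pref_fact_bound n0.
have B_ge : (n.+1 <= B)%N by rewrite /B; lia.
have tE : (t * 2 + (p + q).-1 = e)%N.
  rewrite /t mulnDl !tri2; move: pq0; case: (p) => [|p']; case: (q) => [|q'] //=; nia.
apply: (@leq_trans (A * B ^ e)).
  rewrite -tE expnD mulnA -expnM leq_mul //.
  by apply: leq_trans count_le _; apply: leq_expl.
apply: (@leq_trans (A * (n ^ e * (1 + p + q) ^ e))).
  rewrite -expnMn leq_mul // leq_expl //; rewrite /B; nia.
by rewrite mulnA mulnC leq_mul.
Qed.

End Bound.

(** * The limit vector *)

Lemma sinf_emb (s : Sinf) : exists m, forall n, (m <= n)%N -> exists g : 'S_n, s = emb g.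
Proof.
have [m sm] := sinf_finite s; exists m => n mn.
have s_inj : injective s := can_inj (@sinf_funK s).
have s_lt (i : 'I_n) : (s i < n)%N.
  rewrite ltnNge; apply/negP => n_le; have := ltn_ord i.
  by rewrite -(s_inj _ _ (sm _ (leq_trans mn n_le))) ltnNge n_le.
have g_inj : injective (fun i : 'I_n => Ordinal (s_lt i)).
  by move=> i i' /(congr1 val) /s_inj /val_inj.
exists (perm g_inj); apply: sinfP => i; rewrite /= /ext_fun.
case: insubP => [k _ <-|]; first by rewrite permE.
by rewrite -leqNgt => n_le; rewrite sm // (leq_trans mn).
Qed.

Lemma chi_conjg (R : realType) n la (h x : 'S_n) : young_diagram n la ->
  chi R n la (h * x * h^-1)%g = chi R n la x.
Proof.
move=> la_d; pose b (a : 'I_n) := (nth 0%N la a + rev_ord a)%N.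
have E y : chi R n la y = psi R[i] b y.
  by apply: (@chi_psi _ _ _ la_d _ b); rewrite ?diagram_size.
by rewrite !E; apply: eq_bigr => w _; rewrite wsum_conjg.
Qed.

Lemma complex_ge0E (R : rcfType) (x : R[i]) : 0 <= x -> x = (complex.Re x)%:C%C.
Proof. by case: x => a b; rewrite lecE /= => /andP[/eqP -> _]. Qed.

(** The order on [R[i]] is partial, so the supremum is taken over the real parts, which determine
    nonnegative elements. *)
Lemma nondecreasing_bounded_cauchy (R : realType) (a : nat -> R[i]) (K : R[i]) :
  (forall n, 0 <= a n) -> (forall m n, (m <= n)%N -> a m <= a n) ->
  (forall n, a n <= K) ->
  forall e, 0 < e -> exists N, forall n, (N <= n)%N -> a n - a N < e.
Proof.
move=> a0 a_mono aK e e0.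
have aE n := complex_ge0E (a0 n).
pose r n := complex.Re (a n).
have r_mono m n : (m <= n)%N -> r m <= r n.
  by move=> /a_mono; rewrite lecE => /andP[].
have rK n : r n <= complex.Re K by have := aK n; rewrite lecE => /andP[].
have r_ub : has_ubound (range r) by exists (complex.Re K) => _ [n _ <-].
have r_sup : has_sup (range r) by split=> //; exists (r 0%N), 0%N.
have eE := complex_ge0E (ltW e0).
have Re_e0 : 0 < complex.Re e by move: e0; rewrite {1}eE ltcR.
have [_ [N _ <-] rN] := sup_adherent Re_e0 r_sup.
exists N => n Nn; rewrite eE (aE n) (aE N) -rmorphB /= ltcR.
have rn : r n <= sup (range r) by apply: ub_le_sup => //; exists n.
by rewrite ltrBlDr -/(r n) -/(r N); lra.
Qed.

Section Limit.
Variables (R : realType) (p q : nat).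
Hypothesis pq : (p, q) <> (0%N, 0%N).
Local Notation C := R[i].
Variables (V : completeNormedModType C) (dot : {dot V for Num.conj}).
Variables (j : forall n, {linear Hn R n -> V}).
Variable T : (Sinf * Sinf)%type -> {linear V -> V}.
Hypothesis hT : is_Tz (p%:Z - q%:Z)%:~R dot j T.

Local Notation f := (f_block R p q).

Lemma dot_le (w u : V) : dot u u = 1 -> `|dot w u| <= `|w|.
Proof.
move=> u1; have := dnorm_ge0 dot (w - dot w u *: u).
rewrite dnormB dnormZ u1 mulr1.
have -> : dot w (dot w u *: u) = `|dot w u| ^+ 2.
  by rewrite linearZr_LR /= normCK mulrC.
rewrite (CrealP (rpredX _ (normr_real _))) opprD addrA addrK subr_ge0 => H.
by rewrite -(ler_pXn2r (isT : (0 < 2)%N)) ?nnegrE // (Tz_norm hT).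
Qed.

Let u n : V := j n.+1 (chi_comb f n.+1).

Lemma j_lift m n (g : Hn R n.+1) : (n <= m)%N -> exists g', j m.+1 g' = j n.+1 g.
Proof.
elim: m => [|m IH]; first by rewrite leqn0 => /eqP n0; subst n; exists g.
rewrite leq_eqVlt => /orP[/eqP nE|/IH[g' <-]]; first by subst n; exists g.
by exists (Lz (p%:Z - q%:Z)%:~R g'); rewrite (Tz_compat hT).
Qed.

Lemma dot_u m n (g : Hn R n.+1) : (n <= m)%N ->
  dot (u m) (j n.+1 g) = Hn_dot (chi_comb f n.+1) g.
Proof.
move=> nm; transitivity (dot (u n) (j n.+1 g)); last by rewrite (Tz_isometry hT).
elim: m nm => [|m IH]; first by rewrite leqn0 => /eqP n0; subst n.
rewrite leq_eqVlt => /orP[/eqP nE|nm]; first by subst n.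
rewrite -(IH nm).
have [g' <-] := j_lift g nm.
rewrite -{1}(Tz_compat hT) // !(Tz_isometry hT) // Hn_dot_Lz.
by rewrite Lz_adj_chi_comb //; apply: f_block_coherent.
Qed.

Let a n : C := \sum_(la <- diagrams n.+1) `|f n.+1 la| ^+ 2.

Lemma u_dist m n : (n <= m)%N -> `|u m - u n| ^+ 2 = a m - a n.
Proof.
move=> nm; have dotE l m' : (l <= m')%N -> dot (u m') (u l) = a l.
  by move=> lm; rewrite dot_u // Hn_dot_chi_comb2.
have a_real : (a n)^* = a n.
  by apply: geC0_conj; apply: sumr_ge0 => la _; rewrite exprn_ge0.
rewrite (Tz_norm hT) dnormB !dotE // a_real.
by ring.
Qed.

Lemma u_cvg : exists v, forall e : C, 0 < e ->
  exists N, forall n, (N <= n)%N -> `|v - u n| < e.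
Proof.
have [K aK] := f_block_bound R pq.
have a0 n : 0 <= a n by apply: sumr_ge0 => la _; rewrite exprn_ge0.
have a_mono m n : (m <= n)%N -> a m <= a n.
  by move=> mn; rewrite -subr_ge0 -u_dist // exprn_ge0.
have a_cauchy := nondecreasing_bounded_cauchy a0 a_mono (fun n => aK n.+1 isT).
have u_cauchy : cauchy (u @ \oo)%classic.
  apply: cauchy_exP => e e0; have [N aN] := a_cauchy _ (exprn_gt0 2 e0).
  exists (u N); exists N => // n Nn; rewrite -ball_normE /= distrC.
  rewrite -(ltr_pXn2r (isT : (0 < 2)%N)) ?nnegrE ?(ltW e0) //.
  by rewrite u_dist // aN.
have u_lim : (u @ \oo --> lim (u @ \oo))%classic.
  exact: (@cauchy_cvg V (u @ \oo)%classic _ u_cauchy).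
exists (lim (u @ \oo)%classic) => e e0.
have /cvgrPdist_lt/(_ e e0)[N _ vN] := u_lim.
by exists N => n; apply: vN.
Qed.

Lemma block_vector : exists v, [/\ H_block j p q v, K_invariant T v &
  forall n la, (0 < n)%N -> young_diagram n la -> dot v (xi j n la) = f n la].
Proof.
have [v v_lim] := u_cvg; exists v; split.
- move=> B; rewrite -nbhs_ballE => -[e e0 eB].
  have [N vN] := v_lim e e0; exists (u N); split; last first.
    by apply: eB; rewrite -ball_normE /=; apply: vN.
  exists N.+1, [seq la <- diagrams N.+1 | in_Y p q la], (fun la => f N.+1 la *: chi R N.+1 la).
  split=> // [la|].
    rewrite mem_filter mem_diagrams => /andP[la_Y la_d]; split=> //.
    exact: chi_H_la.
  congr (j _ _); rewrite /chi_comb big_filter [LHS](bigID (in_Y p q)) /=.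
  rewrite [X in _ + X]big1 ?addr0 // => la /negPf la_nY.
  by rewrite /f_block /vd_part la_nY mulr0 scale0r.
- move=> s; have [m s_emb] := sinf_emb s.
  (* An isometry fixing [u l] moves [v] by at most twice the distance from [v] to [u l]; [u l] is
     fixed once [s] lies in S(l + 1), since characters are class functions. *)
  have T_norm w : `|T (s, s) w| = `|w|.
    apply/eqP; rewrite -(eqrXn2 (isT : (0 < 2)%N)) ?normr_ge0 // !(Tz_norm hT).
    by case: (Tz_unitary hT) => _ _ ->.
  apply/eqP; rewrite -subr_eq0 -normr_le0 real_leNgt ?normr_real //.
  apply/negP => d0; have [N vN] := v_lim _ (divr_gt0 d0 (ltr0Sn _ 1)).
  pose l := maxn m N; have vl := vN l (leq_maxr _ _).
  have [g sE] := s_emb l.+1 (leqW (leq_maxl _ _)).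
  have Tu : T (s, s) (u l) = u l.
    rewrite sE -[(emb g, emb g)]/(emb (g, g).1, emb (g, g).2) (Tz_Reg hT) //.
    congr (j _ _); apply/ffunP => x; rewrite ffunE /chi_comb !sum_ffunE.
    rewrite !big_seq; apply: eq_bigr => la; rewrite mem_diagrams => la_d.
    by rewrite [LHS]ffunE [RHS]ffunE /= chi_conjg.
  have : `|T (s, s) v - v| <= `|v - u l| + `|v - u l|.
    rewrite -{1}(T_norm (v - u l)) linearB /= Tu [X in _ <= _ + X]distrC.
    exact: ler_distD.
  by move=> /le_lt_trans/(_ (ltrD vl vl)); rewrite -splitr ltxx.
- move=> [//|n] la _ la_d; apply/eqP; rewrite -subr_eq0 -normr_le0.
  rewrite real_leNgt ?normr_real //; apply/negP => d0.
  have [N vN] := v_lim _ d0; pose l := maxn n N.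
  have vl := vN l (leq_maxr _ _).
  have fE : f n.+1 la = dot (u l) (xi j n.+1 la).
    by rewrite dot_u ?leq_maxl // Hn_dot_chi_comb.
  have xi1 : dot (xi j n.+1 la) (xi j n.+1 la) = 1.
    by rewrite (Tz_isometry hT) // chi_ortho // eqxx.
  have := dot_le (v - u l) xi1; rewrite linearBl /= -fE.
  by move/le_lt_trans/(_ vl); rewrite ltxx.
Qed.

End Limit.

Theorem theorem6p2p1 (R : realType) (k : int) (p q : nat)
    (hk : p%:Z - q%:Z = k) (hpq : (p, q) <> (0%N, 0%N))
    (V : completeNormedModType R[i]) (dot : {dot V for Num.conj})
    (j : forall n, {linear Hn R n -> V})
    (T : (Sinf * Sinf)%type -> {linear V -> V})
    (hT : is_Tz k%:~R dot j T) :
  exists v : V,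
    [/\ H_block j p q v,
        K_invariant T v,
        forall n la, (0 < n)%N -> young_diagram n la -> ~~ in_Y p q la ->
          dot v (xi j n la) = 0 &
        forall n la, (0 < n)%N -> young_diagram n la -> in_Y p q la ->
          dot v (xi j n la) = f_pq R p q n la].
Proof.
rewrite -hk in hT; have [v [v_block v_inv v_f]] := block_vector hpq hT.
exists v; split=> // n la n0 la_d.
  by move=> /negPf la_nY; rewrite v_f // /f_block /vd_part la_nY mulr0.
by move=> la_Y; rewrite v_f // f_pqE.
Qed.
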